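(* Let $p$ be a prime, $n\ge1$, and $(n_1,\dots,n_s)$ a partition of $n$. For each $1\le i\le s$ let $\omega_i\in\mathbb{F}_{p^{n_i}}$ be such that $1,\omega_i,\dots,\omega_i^{n_i-1}$ is a basis of $\mathbb{F}_{p^{n_i}}$ over $\mathbb{F}_p$. Let $L_{i,j}$ ($1\le i\le s$, $1\le j\le n_i$) be $n$ linear forms in $\mathbb{F}_p[X_1,\dots,X_n]$ that are linearly independent over $\mathbb{F}_p$, and set $\lambda_i(\mathbf{x})=L_{i,1}(\mathbf{x})+L_{i,2}(\mathbf{x})\omega_i+\dots+L_{i,n_i}(\mathbf{x})\omega_i^{n_i-1}\in\mathbb{F}_{p^{n_i}}$ for $\mathbf{x}\in\mathbb{Z}^n$. Let $1\le H\le p^{1/2}$ be an integer, $\mathbf{N}\in\mathbb{Z}^n$, and $\mathbf{H}=(H_1,\dots,H_n)$ integers with $H\le H_i\le2H$ for all $i$. Then for every $\varepsilon>0$, $$E((\mathbf{N},\mathbf{N}+\mathbf{H}])\ll_{n,\varepsilon}H^{2n}p^{\varepsilon},$$ where $E((\mathbf{N},\mathbf{N}+\mathbf{H}])=\#\{(\mathbf{x},\mathbf{x}',\mathbf{y},\mathbf{y}')\in(\mathbf{N},\mathbf{N}+\mathbf{H}]^4:\ \lambda_i(\mathbf{x})\lambda_i(\mathbf{y}')=\lambda_i(\mathbf{x}')\lambda_i(\mathbf{y})\text{ in }\mathbb{F}_{p^{n_i}}\text{ for all }1\le i\le s\}$, and the implied constant depends only on $n,\varepsilon$ (uniform in $p$,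 the partition, the $\omega_i$, the forms $L_{i,j}$ and $\mathbf{N}$).
   Context: $(a,b]$ denotes integers $x$ with $a<x\le b$; $(\mathbf{N},\mathbf{N}+\mathbf{H}]=\prod_i(N_i,N_i+H_i]$. Linear forms are evaluated at integer vectors by reducing mod $p$. *)

(* Defs.v *)
From Stdlib Require Import Reals.
From HB Require Import structures.
From mathcomp Require Import all_boot all_order all_algebra all_field.
Set Implicit Arguments. Unset Strict Implicit. Unset Printing Implicit Defensive.
Import Order.TTheory GRing.Theory Num.Theory.
Local Open Scope ring_scope.

(* [omega] generates a power basis 1, omega, ..., omega^(k-1) of F over its
   prime field F_p (F of characteristic p): every element of F is uniquely
   a combination sum_j c_j omega^j with digits c_j in {0,...,p-1}. *)
Definition power_basis (p : nat) (F : finFieldType) (k : nat) (w : F) : Prop :=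
  forall y : F, exists! c : {ffun 'I_k -> 'I_p},
    y = \sum_(j < k) ((c j : nat)%:R : F) * w ^+ j.

Definition forms_lin_indep (p n s : nat) (ns : 'I_s -> nat)
    (L : forall i : 'I_s, 'I_(ns i) -> 'I_n -> 'F_p) : Prop :=
  forall c : forall i : 'I_s, 'I_(ns i) -> 'F_p,
    (forall k : 'I_n, \sum_(i < s) \sum_(j < ns i) c i j * L i j k = 0) ->
    forall i j, c i j = 0.

Definition eval_form (p n : nat) (a : 'I_n -> 'F_p) (x : 'I_n -> int) : 'F_p :=
  \sum_(k < n) a k * (x k)%:~R.

(* lambda_i(x) = L_{i,1}(x) + L_{i,2}(x) w_i + ... + L_{i,n_i}(x) w_i^(n_i-1) in F_i,
   where F_p is embedded in F_i (of characteristic p) via the nat cast. *)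
Definition lam (p n s : nat) (ns : 'I_s -> nat) (F : 'I_s -> finFieldType)
    (w : forall i, F i) (L : forall i : 'I_s, 'I_(ns i) -> 'I_n -> 'F_p)
    (i : 'I_s) (x : 'I_n -> int) : F i :=
  \sum_(j < ns i) ((eval_form (L i j) x : nat)%:R : F i) * w i ^+ j.

(* Points of the box (N, N+H] are encoded by offsets d with 0 < d_k <= H_k,
   the point being N + d. Offsets live in 'I_B with B = (max_k H_k) + 1. *)
Definition boxB (n : nat) (Hs : 'I_n -> nat) : nat := (\max_(k < n) Hs k).+1.

Definition inbox (n : nat) (Hs : 'I_n -> nat) (d : {ffun 'I_n -> 'I_(boxB Hs)}) : bool :=
  [forall k, (0 < (d k : nat) <= Hs k)%N].

Definition pt (n : nat) (N : 'I_n -> int) (B : nat) (d : {ffun 'I_n -> 'I_B}) :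
  'I_n -> int := fun k => N k + (d k : nat)%:Z.

Definition energy (p n s : nat) (ns : 'I_s -> nat) (F : 'I_s -> finFieldType)
    (w : forall i, F i) (L : forall i : 'I_s, 'I_(ns i) -> 'I_n -> 'F_p)
    (N : 'I_n -> int) (Hs : 'I_n -> nat) : nat :=
  #|[set t : {ffun 'I_n -> 'I_(boxB Hs)} * {ffun 'I_n -> 'I_(boxB Hs)}
             * {ffun 'I_n -> 'I_(boxB Hs)} * {ffun 'I_n -> 'I_(boxB Hs)} |
      let: (x, x', y, y') := t in
      [&& inbox x, inbox x', inbox y, inbox y' &
       [forall i : 'I_s,
          lam w L i (pt N x) * lam w L i (pt N y')
          == lam w L i (pt N x') * lam w L i (pt N y)]]]|.

(* Main.v *)
Require Import Defs.
From Stdlib Require Import Reals.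
From Stdlib Require Lra.
From HB Require Import structures.
From mathcomp Require Import all_boot all_order all_algebra all_field.
From mathcomp Require Import fingroup mxabelem.
From mathcomp Require Import zify ring lra.
Set Implicit Arguments. Unset Strict Implicit. Unset Printing Implicit Defensive.
Import Order.TTheory GRing.Theory Num.Theory.
Local Open Scope ring_scope.

(* Put [d = 2n].  A quadruple counted by the energy is a pair of points
   [X = (x, x')], [Y = (y, y')] of [F_p^d] such that, for every [i], the [i]-th
   components of [X] and [Y] lie on one line [z_i] through the origin of the plane
   over [F_(p^n_i)].  The lines form a spread of the [i]-th block, and the lines
   [z = (z_i)] together span a subspace [Gam z] of dimension [n].  Since [X - Y] is
   small, the energy is controlled by the second moment of the number of small
   vectors of [Gam z], over those [z] for which some small vector is nonzero in all
   blocks.  The induction needs patterns [t] in which a block of [Gam] may also be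
   zero ([t_i = 0]) or full ([t_i = 2]); it is on the number of [i] with [t_i = 1].

   For each [z], the small vectors of [Gam z] and of its orthogonal lift to
   orthogonal families of integer vectors.  Hence either [Gam z], or its orthogonal
   at the dual scale [p / H], has at most the expected number of independent small
   vectors, and its count then grows at most like [h ^ dim] in the scale [h].  One
   may therefore descend to the first scale at which [z] is relevant; just below it,
   most small vectors vanish on a fixed nonempty set [J] of blocks, and adding a
   relevant vector to those injects the labels on [J] into the small vectors of the
   pattern in which the blocks of [J] are full.  The two resulting counts have
   normalised product at most the sum of two second moments of smaller patterns.  If
   the orthogonal is not relevant up to scale [sqrt p], a Poisson-type inequality
   transfers its count back to the pattern with the blocks of [J] full, and the loss
   is exactly compensated by the [p ^ n_J] labels on [J]. *)

(** * Small residues and small vectors *)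

Definition srep (p : nat) (x : 'F_p) : int :=
  if ((x : nat).*2 <= p)%N then (x : nat)%:Z else (x : nat)%:Z - p%:Z.

(** The strict inequality leaves only zero at scale 1, which starts the descent in the scale, and
    lets scales add when vectors are added. *)
Definition small (p M : nat) (x : 'F_p) : bool := (`|srep x| < M)%N.

Definition smallv (p d M : nat) (v : 'rV['F_p]_d) : bool :=
  [forall j, small M (v 0 j)].

Definition cnt (p d M m : nat) (G : 'M['F_p]_(m, d)) : nat :=
  #|[set v : 'rV['F_p]_d | (v <= G)%MS && smallv M v]|.

Lemma card_le_fibres (T K : finType) (A : {set T}) (f : T -> K) (c : nat) :
  (forall k, #|[set x in A | f x == k]| <= c)%N -> (#|A| <= #|f @: A| * c)%N.
Proof.
move=> fib; rewrite -sum_nat_const -sum1_card.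
rewrite (partition_big f (fun k => k \in f @: A)) /=; last first.
  by move=> x xA; apply: imset_f.
apply: leq_sum => k _; apply: leq_trans (fib k).
by rewrite -sum1_card; apply/eq_leq/eq_bigl => x; rewrite inE.
Qed.

Lemma card_le_fibresT (T K : finType) (A : {set T}) (f : T -> K) (c : nat) :
  (forall k, #|[set x in A | f x == k]| <= c)%N -> (#|A| <= #|K| * c)%N.
Proof.
by move=> /card_le_fibres /leq_trans; apply; rewrite leq_mul2r max_card orbT.
Qed.

Lemma leq_expn2r (m n e : nat) : (m <= n)%N -> (m ^ e <= n ^ e)%N.
Proof. by case: e => // e; rewrite leq_exp2r. Qed.

Section Small.
Variables (p : nat) (pr_p : prime p).
Local Notation F := 'F_p.

Lemma intr_Fp_eq0 (z : int) : ((z%:~R : F) == 0) = (p %| `|z|)%N.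
Proof.
case: (intP z) => [|n|n]; rewrite ?mulr0z ?eqxx ?dvdn0 //.
  by rewrite -pmulrn -(dvdn_pcharf (pchar_Fp pr_p)) absz_nat.
by rewrite mulrNz oppr_eq0 -pmulrn -(dvdn_pcharf (pchar_Fp pr_p)) abszN absz_nat.
Qed.

Lemma ltn_Fp (x : F) : ((x : nat) < p)%N.
Proof. by have := ltn_ord x; rewrite {2}(Fp_cast pr_p). Qed.

Lemma srepK (x : F) : (srep x)%:~R = x.
Proof.
have xK : ((x : nat)%:Z)%:~R = x by rewrite -pmulrn natr_Zp.
rewrite /srep; case: ifP => _ //.
by rewrite rmorphB /= xK -pmulrn pchar_Fp_0 // subr0.
Qed.

(** The two integers differ by a multiple of [p]. If it is nonzero, then [|z|] is at least [p] minus
    [|srep|], hence at least [|srep|], which is at most [p / 2]. *)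
Lemma srep_min (z : int) : (`|srep (z%:~R : F)| <= `|z|)%N.
Proof.
set x : F := z%:~R; have := intr_Fp_eq0 (z - srep x).
rewrite rmorphB /= srepK subrr eqxx => /esym/dvdnP[k].
have := ltn_Fp x; rewrite /srep; case: ifP => xp xlt zk.
  case: k zk => [|k] zk; first by lia.
  by have : (p <= k.+1 * p)%N by [rewrite leq_pmull]; lia.
case: k zk => [|k] zk; first by lia.
by have : (p <= k.+1 * p)%N by [rewrite leq_pmull]; lia.
Qed.

Lemma smallP (M : nat) (x : F) :
  reflect (exists2 z : int, (`|z| < M)%N & x = z%:~R) (small M x).
Proof.
apply: (iffP idP) => [sx|[z zM ->]]; first by exists (srep x); rewrite ?srepK.
exact: leq_ltn_trans (srep_min z) zM.
Qed.

Lemma small_intr (M : nat) (z : int) : (`|z| < M)%N -> small M (z%:~R : F).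
Proof. by move=> zM; apply/smallP; exists z. Qed.

Lemma small_le (M K : nat) (x : F) : (M <= K)%N -> small M x -> small K x.
Proof. by move=> MK; rewrite /small => /leq_trans; apply. Qed.

Lemma smallD (M K : nat) (x y : F) :
  small M x -> small K y -> small (M + K) (x + y).
Proof.
move=> /smallP[a aM ->] /smallP[b bK ->]; rewrite -rmorphD /=.
by apply: small_intr; lia.
Qed.

Lemma small_sum (I : finType) (M K : nat) (f g : I -> F) :
  (0 < M)%N -> (0 < K)%N -> (0 < #|I|)%N ->
  (forall i, small M (f i)) -> (forall i, small K (g i)) ->
  small (#|I| * M * K) (\sum_i f i * g i).
Proof.
move=> M0 K0 I0 fM gK.
have -> : \sum_i f i * g i = (\sum_i srep (f i) * srep (g i))%:~R.
  by rewrite rmorph_sum; apply: eq_bigr => i _; rewrite rmorphM /= !srepK.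
apply: small_intr.
have : (`|(\sum_i srep (f i) * srep (g i))%R| <= \sum_(i : I) M.-1 * K.-1)%N.
  elim/big_ind2: _ => [|x1 x2 y1 y2 h1 h2|i _] //; first by lia.
  by rewrite abszM leq_mul //; [have := fM i | have := gK i]; rewrite /small; lia.
rewrite sum_nat_const => /leq_ltn_trans; apply.
by rewrite -mulnA ltn_pmul2l //; case: M M0 {fM} K K0 {gK} => // M _ [|K] //= _; nia.
Qed.

(** Cuts the interval from [-H] to [H] into pieces of length [h]. For an [H]-small [x] the shift by
    [H] is nonnegative, so the absolute value loses nothing and [inord] stays in range. *)
Definition cell (H h : nat) (x : F) : 'I_((2 * H) %/ h).+1 :=
  inord (`|srep x + H%:Z| %/ h).

Lemma cellP (H h : nat) (x y : F) : (0 < h)%N ->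
  small H x -> small H y -> cell H h x = cell H h y ->
  (`|(srep x - srep y)%R| < h)%N.
Proof.
move=> h0; rewrite /small => sx sy /(congr1 val).
rewrite /= !inordK; last 2 first.
- by rewrite ltnS leq_div2r //; lia.
- by rewrite ltnS leq_div2r //; lia.
move=> e.
have [dx dy] := (divn_eq `|srep x + H%:Z| h, divn_eq `|srep y + H%:Z| h).
have [rx ry] := (ltn_pmod `|srep x + H%:Z| h0, ltn_pmod `|srep y + H%:Z| h0).
by rewrite e in dx; lia.
Qed.

Lemma card_small (M : nat) : (#|[set x : F | small M x]| <= 2 * M)%N.
Proof.
case: M => [|M]; first by rewrite leqn0 cards_eq0; apply/eqP/setP=> x; rewrite !inE.
have -> : (2 * M.+1 = (M + M.+1).+1)%N by lia.
pose f (x : F) : 'I_(M + M.+1).+1 := inord `|srep x + M%:Z|.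
rewrite -[leqRHS]card_ord -(card_in_imset (f := f)) ?max_card // => x y.
rewrite !inE /small => sx sy /(congr1 val); rewrite /= !inordK; try lia.
by move=> e; rewrite -(srepK x) -(srepK y); congr (_%:~R); lia.
Qed.

Lemma natr_Fp_inj (a b : nat) : (a < p)%N -> (b < p)%N -> a%:R = b%:R :> F -> a = b.
Proof. by move=> ap bp /(congr1 val); rewrite /= !val_Fp_nat // !modn_small. Qed.

Lemma card_small_ge (M : nat) : (M <= p)%N -> (M <= #|[set x : F | small M x]|)%N.
Proof.
move=> Mp; rewrite -[leqLHS]card_ord -(card_imset (f := fun k : 'I_M => (k : nat)%:R : F)).
  apply/subset_leq_card/subsetP => _ /imsetP[k _ ->]; rewrite inE pmulrn.
  exact/small_intr/ltn_ord.
by move=> a b /natr_Fp_inj e; apply/val_inj/e; apply: leq_trans Mp.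
Qed.

Section Vectors.
Variable d : nat.
Implicit Types v w : 'rV[F]_d.

Lemma smallvP (M : nat) v : reflect (forall j, small M (v 0 j)) (smallv M v).
Proof. exact: forallP. Qed.

Lemma smallv_le (M K : nat) v : (M <= K)%N -> smallv M v -> smallv K v.
Proof. by move=> MK /smallvP s; apply/smallvP=> j; apply: small_le (s j). Qed.

Lemma smallvD (M K : nat) v w : smallv M v -> smallv K w -> smallv (M + K) (v + w).
Proof.
by move=> /smallvP sv /smallvP sw; apply/smallvP=> j; rewrite mxE smallD.
Qed.

Lemma smallv0 (M : nat) : (0 < M)%N -> smallv M (0 : 'rV[F]_d).
Proof. by move=> M0; apply/smallvP=> j; rewrite mxE -(mulr0z 1) small_intr. Qed.

Lemma smallv1 v : smallv 1 v -> v = 0.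
Proof.
move=> /smallvP s; apply/rowP=> j; have := s j; rewrite mxE /small ltnS leqn0.
by rewrite absz_eq0 => /eqP e; rewrite -(srepK (v 0 j)) e.
Qed.

Lemma cnt_gt0 (M m : nat) (G : 'M[F]_(m, d)) : (0 < M)%N -> (0 < cnt M G)%N.
Proof. by move=> M0; apply/card_gt0P; exists 0; rewrite inE sub0mx smallv0. Qed.

Lemma cnt_le (M K m : nat) (G : 'M[F]_(m, d)) : (M <= K)%N -> (cnt M G <= cnt K G)%N.
Proof.
move=> MK; apply/subset_leq_card/subsetP=> v; rewrite !inE => /andP[-> /=].
exact: smallv_le.
Qed.

(** Translate [X] by one of its elements. This bounds the fibres of all the pigeonhole maps
    below. *)
Lemma card_close_le_cnt (M m : nat) (G : 'M[F]_(m, d)) (X : {set 'rV[F]_d}) :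
  (forall v w, v \in X -> w \in X -> (v - w <= G)%MS && smallv M (v - w)) ->
  (#|X| <= cnt M G)%N.
Proof.
move=> close; have [->|[w wX]] := set_0Vmem X; first by rewrite cards0.
rewrite -(card_imset X (addIr (- w))); apply/subset_leq_card/subsetP.
by move=> _ /imsetP[v vX ->]; rewrite inE; apply: close.
Qed.

Lemma cnt_cells (H h m : nat) (G : 'M[F]_(m, d)) : (0 < h)%N ->
  (cnt H G <= ((2 * H) %/ h).+1 ^ d * cnt h G)%N.
Proof.
move=> h0; pose f v : {ffun 'I_d -> 'I_((2 * H) %/ h).+1} := [ffun j => cell H h (v 0 j)].
apply: leq_trans (card_le_fibresT (f := f) (c := cnt h G) _) _; last first.
  by rewrite card_ffun !card_ord.
move=> k; apply: card_close_le_cnt => v w; rewrite !inE.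
move=> /andP[/andP[vG /smallvP sv] /eqP <-] /andP[/andP[wG /smallvP sw] /eqP/ffunP e].
rewrite addmx_sub ?eqmx_opp //=; apply/smallvP=> j.
have := e j; rewrite !ffunE => /esym/cellP => /(_ h0 (sv j) (sw j)) c.
by rewrite !mxE -(srepK (v 0 j)) -(srepK (w 0 j)) -rmorphB small_intr.
Qed.

Lemma cnt_mulr (c h m : nat) (G : 'M[F]_(m, d)) : (0 < h)%N ->
  (cnt (c * h) G <= (2 * c).+1 ^ d * cnt h G)%N.
Proof. by move=> h0; have := cnt_cells (c * h) G h0; rewrite mulnA mulnK. Qed.

(** Some [\rank G] columns of a row base form an invertible matrix, so a vector of the row space is
    determined by its entries there. *)
Lemma cnt_le_rank (M m : nat) (G : 'M[F]_(m, d)) : (cnt M G <= (2 * M) ^ \rank G)%N.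
Proof.
have full : row_full (row_base G)^T by rewrite /row_full mxrank_tr eq_row_base.
pose f := fullrankfun full.
have fu : rowsub f (row_base G)^T \in unitmx by apply: fullrowsub_unit.
pose B : {set 'rV[F]_(\rank G)} := [set u | smallv M u].
have cB : (#|B| <= (2 * M) ^ \rank G)%N.
  pose g (u : 'rV[F]_(\rank G)) : {ffun 'I_(\rank G) -> F} := [ffun j => u 0 j].
  have gi : injective g.
    by move=> u u' /ffunP e; apply/rowP=> j; have := e j; rewrite !ffunE.
  rewrite -(card_imset _ gi).
  apply: leq_trans (_ : #|ffun_on (mem [set x : F | small M x])| <= _)%N.
    apply/subset_leq_card/subsetP=> h /imsetP[u uB ->].
    have /forallP su : smallv M u by move: uB; rewrite inE.
    by apply/ffun_onP=> j; rewrite ffunE inE su.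
  by rewrite card_ffun_on card_ord; apply/leq_expn2r/card_small.
apply: leq_trans cB; rewrite /cnt.
rewrite -(card_in_imset (f := colsub f : 'rV[F]_d -> _)).
  apply/subset_leq_card/subsetP=> h /imsetP[v]; rewrite inE => /andP[_ /smallvP sv] ->.
  by rewrite inE; apply/forallP=> j; rewrite mxE.
move=> v w; rewrite !inE => /andP[vG _] /andP[wG _].
rewrite -(eq_row_base G) in vG; rewrite -(eq_row_base G) in wG.
case/submxP: vG => a ->; case/submxP: wG => b -> e.
congr (_ *m _); apply: (can_inj (mulmxK (_ : (colsub f (row_base G)) \in unitmx))).
  by rewrite -unitmx_tr trmx_mxsub.
by move: e; rewrite !mulmx_colsub.
Qed.
End Vectors.
End Small.

(** * Rank of the lifted lattice points *)

Lemma det_id_subst_col (R : comNzRingType) (k : nat) (i : 'I_k) (A : 'M[R]_k) :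
  (forall a b, b != i -> A a b = (a == b)%:R) -> \det A = A i i.
Proof.
move=> Aid; rewrite (expand_det_row _ i) (bigD1 i) //= big1 ?addr0; last first.
  by move=> j ji; rewrite Aid // eq_sym (negPf ji) mul0r.
rewrite /cofactor addnn -signr_odd odd_double mul1r.
suff -> : row' i (col' i A) = 1%:M by rewrite det1 mulr1.
by apply/matrixP=> a b; rewrite !mxE Aid ?(inj_eq lift_inj) // eq_sym neq_lift.
Qed.

(* Maximising a minor bounds all coordinates by those of the minor (Cramer). *)
Lemma dominant_coordinates (R : realFieldType) (k d : nat) (B : 'M[R]_(k, d)) :
  row_free B -> exists f : 'I_k -> 'I_d, exists C : 'M[R]_(k, d),
    (forall i j, `|C i j| <= 1) /\
    (forall v : 'rV[R]_d, (v <= B)%MS -> v = colsub f v *m C).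
Proof.
move=> freeB.
have full : row_full B^T by rewrite /row_full mxrank_tr.
pose f0 : {ffun 'I_k -> 'I_d} := fullrankfun full.
have u0 : \det (colsub f0 B) != 0.
  have := fullrowsub_unit full; rewrite -unitmx_tr trmx_mxsub trmxK unitmxE.
  by rewrite unitfE.
have [f _ fmax] := @arg_maxP _ _ _ f0 predT (fun f : {ffun 'I_k -> 'I_d} =>
  `|\det (colsub f B)|) isT.
have uf : \det (colsub f B) != 0.
  by rewrite -normr_gt0; apply: lt_le_trans (fmax f0 isT); rewrite normr_gt0.
have Bf : colsub f B \in unitmx by rewrite unitmxE unitfE.
exists f, (invmx (colsub f B) *m B); split; last first.
  move=> _ /submxP[u ->]; rewrite -mulmx_colsub -!mulmxA; congr (_ *m _).
  by rewrite mulKVmx.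
(* By Cramer's rule [C i j] is the quotient of the minors on [f'] and on [f], where [f'] has [j] in
   place of the [i]-th chosen column. *)
move=> i j; set C := _ *m B.
pose f' : {ffun 'I_k -> 'I_d} := [ffun a => if a == i then j else f a].
have fC : colsub f C = 1%:M by rewrite -mulmx_colsub mulVmx.
have BC : colsub f' B = colsub f B *m colsub f' C by rewrite mulmx_colsub mulKVmx.
have dC : \det (colsub f' C) = C i j.
  rewrite (@det_id_subst_col _ _ i) ?mxE ?ffunE ?eqxx // => a b bi.
  by have /matrixP/(_ a b) := fC; rewrite !mxE ffunE (negPf bi).
have : `|\det (colsub f' B)| <= `|\det (colsub f B)| := fmax f' isT.
by rewrite BC det_mulmx dC normrM -[X in _ <= X -> _]mulr1 ler_pM2l ?normr_gt0.
Qed.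

Section Lift.
Variables (p : nat) (pr_p : prime p) (d : nat).
Local Notation F := 'F_p.

Definition liftv (v : 'rV[F]_d) : 'rV[rat]_d := \row_j (srep (v 0 j))%:~R.

Definition smallset (M m : nat) (G : 'M[F]_(m, d)) : {set 'rV[F]_d} :=
  [set v | (v <= G)%MS && smallv M v].

(** Its rank is the number of small vectors of [G] whose integer lifts are independent over the
    rationals. *)
Definition liftmx (M m : nat) (G : 'M[F]_(m, d)) : 'M[rat]_(#|smallset M G|, d) :=
  \matrix_i liftv (enum_val i).

Lemma liftv_sub (M m : nat) (G : 'M[F]_(m, d)) v :
  v \in smallset M G -> (liftv v <= liftmx M G)%MS.
Proof.
move=> vS; have -> : liftv v = row (enum_rank_in vS v) (liftmx M G).
  by rewrite rowK enum_rankK_in.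
exact: row_sub.
Qed.

(** Pigeonhole into cells of side [h], but only in the [k] dominant coordinates of the lifts. The
    others are combinations of these with coefficients at most 1, so two vectors in one cell differ
    by less than [d * h] everywhere. *)
Lemma cnt_lift_rank (H h m : nat) (G : 'M[F]_(m, d)) : (0 < h)%N -> (h <= H)%N ->
  (cnt H G * h ^ \rank (liftmx H G) <= (3 * H) ^ \rank (liftmx H G) * cnt (d * h) G)%N.
Proof.
move=> h0 hH; set k := \rank _.
have [f [C [C1 Cv]]] := dominant_coordinates (row_base_free (liftmx H G)).
pose g (v : 'rV[F]_d) : {ffun 'I_k -> 'I_((2 * H) %/ h).+1} :=
  [ffun i => cell H h (v 0 (f i))].
have : (cnt H G <= #|{ffun 'I_k -> 'I_((2 * H) %/ h).+1}| * cnt (d * h) G)%N.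
  apply: (card_le_fibresT (f := g)) => c; apply: card_close_le_cnt => v w.
  rewrite !inE => /andP[vS /eqP gv] /andP[wS /eqP gw].
  have [/andP[vG /smallvP sv] /andP[wG /smallvP sw]] := (vS, wS).
  rewrite addmx_sub ?eqmx_opp //=; apply/smallvP => j; rewrite !mxE.
  rewrite -(srepK pr_p (v 0 j)) -(srepK pr_p (w 0 j)) -rmorphB /=.
  apply: small_intr => //.
  have e : liftv v - liftv w = colsub f (liftv v - liftv w) *m C.
    apply: Cv; rewrite eq_row_base addmx_sub ?eqmx_opp // liftv_sub // inE //.
  have /rowP/(_ j) := e; rewrite !mxE => ej.
  have k0 : (0 < d * h)%N by rewrite muln_gt0 h0 (leq_ltn_trans (leq0n j)).
  have small_f i : (`|(srep (v 0 (f i)) - srep (w 0 (f i)))%R| < h)%N.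
    apply: (cellP pr_p h0 (sv _) (sw _)).
    by have := gv; rewrite -gw => /ffunP/(_ i); rewrite !ffunE.
  have : `|(srep (v 0 j) - srep (w 0 j))%:~R : rat| <= \sum_(i < k) h.-1%:R.
    rewrite rmorphB /= ej; apply: le_trans (ler_norm_sum _ _ _) _.
    apply: ler_sum => i _; rewrite normrM -[leRHS]mulr1 ler_pM //.
    rewrite !mxE -rmorphB /= -intr_norm pmulrn ler_int.
    by have := small_f i; lia.
  rewrite sumr_const card_ord -mulrnA -intr_norm pmulrn ler_int => le.
  have kd : (k <= d)%N by exact: rank_leq_col.
  have : (`|(srep (v 0 j) - srep (w 0 j))%R| <= h.-1 * k)%N by lia.
  move=> /leq_ltn_trans; apply.
  apply: leq_ltn_trans (_ : h.-1 * d < _)%N; first by rewrite leq_mul2l kd orbT.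
  by rewrite mulnC ltn_pmul2l; case: (h) h0 (d) k0 => // ? _ [].
rewrite card_ffun !card_ord => le.
apply: leq_trans (leq_mul le (leqnn _)) _.
(* As [h <= H], the number of cells per coordinate, [2H / h + 1], is at most [3H / h]. *)
rewrite mulnAC -expnMn leq_mul2r leq_expn2r ?orbT //.
by have := leq_trunc_div (2 * H) h; nia.
Qed.

(** The integer inner product of two lifts is divisible by [p] and smaller than [p] in absolute
    value, hence zero; orthogonal families over the rationals have ranks adding up to at most
    [d]. *)
Lemma lift_rank_orthogonal (H K m m' : nat) (G : 'M[F]_(m, d)) (G' : 'M[F]_(m', d)) :
  G *m G'^T = 0 -> (d * H * K <= p)%N ->
  (\rank (liftmx H G) + \rank (liftmx K G') <= d)%N.
Proof.
move=> GG' le; rewrite -(mxrank_tr (liftmx K G')); apply: mulmx0_rank_max.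
apply/matrixP=> a b; rewrite !mxE.
have := enum_valP a; have := enum_valP b; rewrite !inE.
set v := enum_val a; set w := enum_val b.
move=> /andP[/submxP[y wE] /smallvP sw] /andP[/submxP[x vE] /smallvP sv].
under eq_bigr => j _ do rewrite !mxE -rmorphM /=.
rewrite -rmorph_sum /=; set z : int := \sum_j _.
have [d0|d0] := posnP d.
  by rewrite /z big1 // => j _; move: (ltn_ord j); rewrite {2}d0.
have H0 : (0 < H)%N by apply: leq_ltn_trans (leq0n _) (sv (Ordinal d0)).
have K0 : (0 < K)%N by apply: leq_ltn_trans (leq0n _) (sw (Ordinal d0)).
have zE : z%:~R = 0 :> F.
  transitivity ((v *m w^T) 0 0); last first.
    by rewrite vE wE trmx_mul mulmxA -(mulmxA x) GG' mulmx0 mul0mx mxE.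
  rewrite rmorph_sum mxE; apply: eq_bigr => j _.
  by rewrite rmorphM /= !srepK // mxE.
move/eqP: zE; rewrite intr_Fp_eq0 // => pz.
have zlt : (`|z| < p)%N.
  apply: leq_trans le; rewrite -[d in (d * _ * _)%N]card_ord.
  have : (`|z| <= \sum_(j < d) H.-1 * K.-1)%N.
    rewrite /z; elim/big_ind2: _ => [|x1 x2 y1 y2 h1 h2|i _] //; first by lia.
    by rewrite abszM leq_mul // -ltnS prednK //; [apply: sv | apply: sw].
  rewrite sum_nat_const => /leq_ltn_trans; apply.
  by rewrite -mulnA ltn_pmul2l ?card_ord //; case: (H) H0 (K) K0 => // M _ [|L] //= _; nia.
suff -> : z = 0 by [].
by move: pz; have [/eqP|z0 /dvdn_leq] := posnP `|z|%N; [rewrite absz_eq0 => /eqP | lia].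
Qed.

(** Since [h <= H], the exponent of [H / h] given by [cnt_lift_rank] may be raised from the lift
    rank to [r]; [cnt_mulr] then removes the dilation by [d]. *)
Lemma cnt_slope (H h r m : nat) (G : 'M[F]_(m, d)) :
  (0 < h)%N -> (h <= H)%N -> (\rank (liftmx H G) <= r)%N -> (r <= d)%N ->
  (cnt H G * h ^ r <= 3 ^ d * (2 * d).+1 ^ d * H ^ r * cnt h G)%N.
Proof.
move=> h0 hH kr rd; have := cnt_lift_rank G h0 hH.
set k := \rank _ in kr * => le.
rewrite -(subnK kr) (expnD h) (expnD H) mulnCA.
apply: leq_trans (leq_mul (leqnn _) le) _.
rewrite expnMn; have := cnt_mulr pr_p d G h0 => cl.
apply: leq_trans (leq_mul (leq_expn2r (r - k) hH) (leq_mul (leqnn _) cl)) _.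
have k3 : (3 ^ k <= 3 ^ d)%N by rewrite leq_exp2l // (leq_trans kr).
move: (H ^ (r - k))%N (H ^ k)%N (cnt h G) ((2 * d).+1 ^ d)%N (3 ^ k)%N (3 ^ d)%N k3.
move=> a b c e x y xy.
have -> : (a * (x * b * (e * c)) = x * (e * (a * b) * c))%N by ring.
by rewrite (leq_trans (leq_mul xy (leqnn _))) // !mulnA.
Qed.

(* Small vectors of [G] and of its dual lift to orthogonal families over the
   rationals, so one of the two families has at most the expected rank. *)
Lemma slope_dichotomy (H K r r' m m' : nat) (G : 'M[F]_(m, d)) (G' : 'M[F]_(m', d)) :
  G *m G'^T = 0 -> (d * H * K <= p)%N -> (r + r' = d)%N ->
  (forall h, (0 < h <= H)%N ->
     (cnt H G * h ^ r <= 3 ^ d * (2 * d).+1 ^ d * H ^ r * cnt h G)%N) \/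
  (forall h, (0 < h <= K)%N ->
     (cnt K G' * h ^ r' <= 3 ^ d * (2 * d).+1 ^ d * K ^ r' * cnt h G')%N).
Proof.
move=> GG' le rr'; have := lift_rank_orthogonal GG' le.
have [kr _|kr kk] := leqP (\rank (liftmx H G)) r.
  by left=> h /andP[h0 hH]; apply: cnt_slope => //; lia.
by right=> h /andP[h0 hK]; apply: cnt_slope => //; lia.
Qed.
End Lift.

(** * Duality between counts *)

Lemma ler_eq (R : numDomainType) (x y : R) : x = y -> x <= y.
Proof. by move=> ->. Qed.

Section Duality.
Variables (p : nat) (pr_p : prime p).
Local Notation F := 'F_p.

Lemma sum_shift (f : F -> rat) (c : F) : \sum_x f (x + c) = \sum_x f x.
Proof. by rewrite [RHS](reindex_inj (addIr c)). Qed.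

(** A nonzero linear form takes every value equally often: averaging over the translates of [a]
    along a vector [b] with [u . b = 1] turns each term into the full sum of [f]. *)
Lemma sum_linear_form_eq0 (r : nat) (u : 'rV[F]_r) (f : F -> rat) (c : F) :
  u != 0 -> \sum_x f x = 0 ->
  \sum_(a : 'rV[F]_r) f (c + (u *m a^T) 0 0) = 0.
Proof.
move=> /rV0Pn[j uj] f0.
pose b : 'rV[F]_r := (u 0 j)^-1 *: delta_mx 0 j.
have ub : (u *m b^T) 0 0 = 1.
  rewrite mxE (bigD1 j) //= !mxE !eqxx mulr1 mulfV // big1 ?addr0 // => i ij.
  by rewrite !mxE (negPf ij) andbF mulr0 mulr0.
set S := LHS.
have shift t : S = \sum_(a : 'rV[F]_r) f (c + (u *m a^T) 0 0 + t).
  rewrite /S (reindex_inj (addIr (t *: b))); apply: eq_bigr => a _.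
  have -> : (u *m (a + t *: b)^T) 0 0 = (u *m a^T) 0 0 + t * (u *m b^T) 0 0.
    by rewrite linearD linearZ /= mulmxDr -scalemxAr mxE; congr (_ + _); rewrite mxE.
  by rewrite ub mulr1 addrA.
have : S *+ p = 0.
  rewrite -[p](card_Fp pr_p) -sumr_const (eq_bigr _ (fun t _ => shift t)) exchange_big big1 //.
  by move=> a _; under eq_bigr => t _ do rewrite addrC; rewrite sum_shift.
by move=> /eqP; rewrite mulrn_eq0 -leqn0 leqNgt prime_gt0 //= => /eqP.
Qed.

(* The extra translation [b] makes distinct [u] pairwise independent, so that
   only the diagonal survives. *)
Lemma second_moment (r : nat) (T : {set 'rV[F]_r}) (f : F -> rat) :
  \sum_x f x = 0 ->
  \sum_(a : 'rV[F]_r) \sum_b (\sum_(u in T) f (b + (u *m a^T) 0 0)) ^+ 2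
  = #|T|%:R * p%:R ^+ r * \sum_x f x ^+ 2.
Proof.
move=> f0.
pose g (u u' : 'rV[F]_r) :=
  \sum_(a : 'rV[F]_r) \sum_b f (b + (u *m a^T) 0 0) * f (b + (u' *m a^T) 0 0).
transitivity (\sum_(u in T) \sum_(u' in T) g u u').
  rewrite /g.
  under [RHS]eq_bigr => u _ do rewrite exchange_big /=.
  rewrite [RHS]exchange_big /=; apply: eq_bigr => a _.
  under [RHS]eq_bigr => u _ do rewrite exchange_big /=.
  rewrite [RHS]exchange_big /=; apply: eq_bigr => b _.
  by rewrite expr2 big_distrlr.
have gE u u' : g u u' = (u == u')%:R * (p%:R ^+ r * \sum_x f x ^+ 2).
  have g1 : g u u' = \sum_(a : 'rV[F]_r) \sum_b f b * f (b + ((u' - u) *m a^T) 0 0).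
    apply: eq_bigr => a _; rewrite -[RHS](sum_shift _ ((u *m a^T) 0 0)).
    apply: eq_bigr => b _; congr (_ * f _).
    have -> : ((u' - u) *m a^T) 0 0 = (u' *m a^T) 0 0 - (u *m a^T) 0 0.
      by rewrite mulmxBl mxE; congr (_ + _); rewrite mxE.
    ring.
  rewrite g1; have [<-|uu'] := eqVneq u u'.
    rewrite mul1r; under eq_bigr => a _ do
      under eq_bigr => b _ do rewrite subrr mul0mx mxE addr0 -expr2.
    by rewrite sumr_const card_mx (card_Fp pr_p) mul1n -[_ *+ _]mulr_natl natrX.
  rewrite mul0r exchange_big big1 // => b _; rewrite -mulr_sumr.
  by rewrite sum_linear_form_eq0 ?mulr0 // subr_eq0 eq_sym.
transitivity (\sum_(u in T) p%:R ^+ r * \sum_x f x ^+ 2); last first.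
  by rewrite sumr_const -[RHS]mulrA mulr_natl.
apply: eq_bigr => u uT; rewrite (bigD1 u) //= gE eqxx mul1r [X in _ + X]big1 ?addr0 //.
by move=> u' /andP[_ ne]; rewrite gE eq_sym (negPf ne) mul0r.
Qed.

(** Let [f] be the balanced indicator of the [2m]-small residues [A]. If [a] is in [I] and [b] is
    [m]-small, every [b + u . a] lies in [A], so the inner sum of [second_moment] takes its maximal
    value [#|T| * (p - #|A|)]. Too many such [a] would exceed the second moment. *)
Lemma card_small_pairing (r m : nat) (I T : {set 'rV[F]_r}) :
  (0 < m)%N -> (8 * m <= p)%N ->
  (forall a u, a \in I -> u \in T -> small m ((u *m a^T) 0 0)) ->
  (#|I| * #|T| <= 8 * p ^ r)%N.
Proof.
move=> m0 mp sm.
pose A := [set x : F | small (m + m) x]; pose B := [set x : F | small m x].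
have Ale : (#|A| <= 4 * m)%N by apply: leq_trans (card_small pr_p _) _; lia.
have Bge : (m <= #|B|)%N by apply: card_small_ge => //; lia.
pose f (x : F) : rat := p%:R * (x \in A)%:R - #|A|%:R.
have sA : \sum_(x : F) ((x \in A)%:R : rat) = #|A|%:R.
  by rewrite -sum1_card natr_sum [RHS]big_mkcond /=; apply: eq_bigr => x _; case: (x \in A).
have f0 : \sum_x f x = 0.
  by rewrite sumrB -mulr_sumr sA sumr_const (card_Fp pr_p) -[#|A|%:R *+ p]mulr_natl subrr.
have f2 : \sum_x f x ^+ 2 = p%:R * #|A|%:R * (p%:R - #|A|%:R).
  transitivity (\sum_(x : F) ((p%:R * (p%:R - #|A|%:R *+ 2)) * (x \in A)%:R + #|A|%:R ^+ 2 : rat)).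
    by apply: eq_bigr => x _; rewrite /f; case: (x \in A) => /=; ring.
  rewrite big_split /= -mulr_sumr sA sumr_const (card_Fp pr_p) -[(#|A|%:R ^+ 2) *+ p]mulr_natl; ring.
have [->|T0] := posnP #|T|; first by rewrite muln0.
pose N : rat := #|T|%:R; pose q : rat := p%:R; pose a : rat := #|A|%:R.
have key : #|I|%:R * #|B|%:R * (N * (q - a)) ^+ 2 <= N * q ^+ r * (q * a * (q - a)).
  rewrite -f2 -second_moment //.
  apply: le_trans (_ : \sum_(x in I) \sum_(b in B) (N * (q - a)) ^+ 2 <= _).
    by rewrite !sumr_const -mulrnA -natrM [leLHS]mulr_natl mulnC.
  have pos (x : 'rV[F]_r) (b : F) : 0 <= (\sum_(u in T) f (b + (u *m x^T) 0 0)) ^+ 2.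
    exact: sqr_ge0.
  rewrite [leRHS](bigID (mem I)) /= -[leLHS]addr0 lerD ?sumr_ge0 //; last first.
    by move=> x _; rewrite sumr_ge0.
  apply: ler_sum => x xI; rewrite [leRHS](bigID (mem B)) /= -[leLHS]addr0.
  rewrite lerD ?sumr_ge0 //; apply: ler_sum => b; rewrite inE => sb.
  apply/ler_eq; congr (_ ^+ 2); rewrite mulr_natl -sumr_const.
  apply: eq_bigr => u uT; rewrite /f inE smallD ?mulr1 //; exact: sm.
have q0 : 0 < q by rewrite ltr0n prime_gt0.
have N0 : 0 < N by rewrite ltr0n.
have b0 : (m%:R : rat) <= #|B|%:R by rewrite ler_nat.
have a4 : a <= 4 * m%:R by rewrite -natrM ler_nat.
have m0r : 0 < (m%:R : rat) by rewrite ltr0n.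
have q8 : 8 * m%:R <= q by rewrite -natrM ler_nat.
(* The hypothesis [8 * m <= p] makes [A] at most half of the field. *)
have qa : q <= 2 * (q - a) by lra.
have i0 : 0 <= (#|I|%:R : rat) by [].
have k1 : #|I|%:R * #|B|%:R * (N * (q - a)) <= q ^+ r * (q * a).
  rewrite -(ler_pM2r (_ : 0 < N * (q - a))); last by rewrite mulr_gt0 //; lra.
  have -> : #|I|%:R * #|B|%:R * (N * (q - a)) * (N * (q - a)) =
    #|I|%:R * #|B|%:R * (N * (q - a)) ^+ 2 by ring.
  by apply: le_trans key _; apply/ler_eq; ring.
have k2 : #|I|%:R * N * m%:R * q <= #|I|%:R * #|B|%:R * (N * (q - a)) * 2.
  have -> : #|I|%:R * #|B|%:R * (N * (q - a)) * 2 = #|I|%:R * N * (#|B|%:R * (2 * (q - a))) by ring.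
  by rewrite -mulrA ler_wpM2l ?mulr_ge0 ?(ltW N0) // ler_pM // ltW.
have k3 : q ^+ r * (q * a) * 2 <= q ^+ r * 8 * m%:R * q.
  have -> : q ^+ r * (q * a) * 2 = q ^+ r * q * (2 * a) by ring.
  have -> : q ^+ r * 8 * m%:R * q = q ^+ r * q * (8 * m%:R) by ring.
  by rewrite ler_wpM2l ?mulr_ge0 ?exprn_ge0 ?(ltW q0) //; lra.
have : #|I|%:R * N * (m%:R * q) <= q ^+ r * 8 * (m%:R * q).
  rewrite !mulrA; apply: le_trans k2 (le_trans _ k3).
  by rewrite ler_pM2r.
by rewrite ler_pM2r ?mulr_gt0 // /N /q -natrX -!natrM ler_nat [X in (_ <= X)%N]mulnC.
Qed.

(** Pair the [Y ^ d] vectors of a box with a basis of [G]. Two vectors with the same image differ by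
    a small vector of [G'], so there are at least [Y ^ d / cnt Y G'] images. They pair to small
    values with the coefficient vectors of the small elements of [G], and [card_small_pairing]
    applies. *)
Lemma cnt_duality (d X Y m m' : nat) (G : 'M[F]_(m, d)) (G' : 'M[F]_(m', d)) :
  G *m G'^T = 0 -> (\rank G + \rank G' = d)%N -> (0 < d)%N -> (0 < X)%N -> (0 < Y)%N ->
  (8 * (d * X * Y) <= p)%N ->
  (cnt X G * Y ^ d <= 8 * p ^ \rank G * cnt Y G')%N.
Proof.
move=> GG' rk d0 X0 Y0 le.
have Yp : (Y <= p)%N by apply: leq_trans le; rewrite !mulnA leq_pmull // !muln_gt0 d0 X0.
pose R := row_base G.
have Rfree : row_free R by apply: row_base_free.
(* By the rank hypothesis [G'] is the whole annihilator of [G]. *)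
have kerE (w : 'rV[F]_d) : w *m R^T = 0 -> (w <= G')%MS.
  move=> wR; have : (w <= kermx R^T)%MS by apply/sub_kermxP.
  suff -> : (w <= kermx R^T)%MS = (w <= G')%MS by [].
  have GR : (G' <= kermx R^T)%MS.
    apply/sub_kermxP; rewrite /R; have /submxP[D ->] : (row_base G <= G)%MS by rewrite eq_row_base.
    rewrite trmx_mul mulmxA -[G' *m _]trmxK trmx_mul trmxK GG' trmx0 mul0mx //.
  suff /eqmxP e : (G' == kermx R^T)%MS by rewrite e.
  by rewrite -(mxrank_leqif_eq GR) mxrank_ker mxrank_tr eq_row_base; apply/eqP; lia.
pose W : {set 'rV[F]_d} := [set \row_j ((k j : nat)%:R : F) | k : {ffun 'I_d -> 'I_Y}].
have cW : #|W| = (Y ^ d)%N.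
  rewrite card_imset ?card_ffun ?card_ord // => k k' /rowP e; apply/ffunP=> j.
  apply/val_inj; have := e j; rewrite !mxE => /natr_Fp_inj; apply=> //.
    exact: leq_trans (ltn_ord _) Yp.
  exact: leq_trans (ltn_ord _) Yp.
pose phi (w : 'rV[F]_d) : 'rV[F]_(\rank G) := w *m R^T.
have leW : (Y ^ d <= #|phi @: W| * cnt Y G')%N.
  rewrite -cW; apply: card_le_fibres => c; apply: card_close_le_cnt => v w.
  rewrite !inE => /andP[vW /eqP vc] /andP[wW /eqP wc]; apply/andP; split.
    by apply: kerE; rewrite mulmxBl; apply/eqP; rewrite subr_eq0 -/(phi v) -/(phi w) vc wc.
  case/imsetP: vW => k _ ->; case/imsetP: wW => k' _ ->.
  apply/forallP=> j; rewrite !mxE !pmulrn -rmorphB /=; apply: small_intr => //.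
  by case: (k j) (k' j) => [a aY] [b bY] /=; lia.
pose T : {set 'rV[F]_(\rank G)} := [set u | smallv X (u *m R)].
have cT : (cnt X G <= #|T|)%N.
  rewrite -(card_imset _ (row_free_inj Rfree : injective (mulmx^~ R : 'rV_(_) -> _))).
  apply/subset_leq_card/subsetP=> v; rewrite inE => /andP[vG sv].
  have /submxP[u uE] : (v <= R)%MS by rewrite eq_row_base.
  by apply/imsetP; exists u => //; rewrite inE -uE.
have : (#|phi @: W| * #|T| <= 8 * p ^ \rank G)%N.
  apply: (@card_small_pairing _ (d * X * Y)) => //; first by rewrite !muln_gt0 d0 X0.
  move=> a u /imsetP[w /imsetP[k _ ->] ->]; rewrite inE => /forallP su.
  rewrite trmx_mul trmxK mulmxA mxE -[d in (d * _ * _)%N]card_ord.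
  apply: small_sum => //; rewrite ?card_ord // => j.
  rewrite !mxE pmulrn; apply: small_intr => //; exact: ltn_ord.
move=> lt; apply: leq_trans (leq_mul cT leW) _.
by rewrite mulnCA mulnA leq_mul2r lt orbT.
Qed.
End Duality.

(** * Block systems with partial spreads *)

(* [bs_e] are the projections on the blocks, and the [bs_A i z] for
   [z \in bs_Z i] form a partial spread of the [i]-th block. *)
Record blocks (p d s : nat) := Blocks {
  bs_n : 'I_s -> nat;
  bs_L : finType;
  bs_z0 : bs_L;
  bs_e : 'I_s -> 'M['F_p]_d;
  bs_Z : 'I_s -> {set bs_L};
  bs_A : 'I_s -> bs_L -> 'M['F_p]_d;
  bs_n_gt0 : forall i, (0 < bs_n i)%N;
  bs_dim : d = (\sum_i 2 * bs_n i)%N;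
  bs_idem : forall i j, bs_e i *m bs_e j = if i == j then bs_e i else 0;
  bs_sum : \sum_i bs_e i = 1%:M;
  bs_rank_e : forall i, \rank (bs_e i) = (2 * bs_n i)%N;
  bs_sub : forall i z, z \in bs_Z i -> (bs_A i z <= bs_e i)%MS;
  bs_rank_A : forall i z, z \in bs_Z i -> \rank (bs_A i z) = bs_n i;
  bs_spread : forall i z z' (v : 'rV['F_p]_d), z \in bs_Z i -> z' \in bs_Z i ->
    z != z' -> (v <= bs_A i z)%MS -> (v <= bs_A i z')%MS -> v = 0;
  bs_card : forall i, (#|bs_Z i| <= 2 * p ^ bs_n i)%N }.

Arguments bs_A {p d s} _ _ _.

Section Patterns.
Variable s : nat.
Implicit Types (t : {ffun 'I_s -> 'I_3}) (J : {set 'I_s}) (c : 'I_3).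

Definition ones t : {set 'I_s} := [set i | t i == 1%N :> nat].
Definition put J c t : {ffun 'I_s -> 'I_3} := [ffun i => if i \in J then c else t i].
(** Reversal exchanges 0 and 2, as orthogonality exchanges the zero and the full block, and fixes
    1. *)
Definition dualp t : {ffun 'I_s -> 'I_3} := [ffun i => rev_ord (t i)].

Lemma dualp_put J c t : dualp (put J c t) = put J (rev_ord c) (dualp t).
Proof. by apply/ffunP=> i; rewrite !ffunE; case: ifP. Qed.

Lemma ones_dualp t : ones (dualp t) = ones t.
Proof. by apply/setP=> i; rewrite !inE ffunE; case: (t i) => [] [|[|[]]]. Qed.

Lemma ones_put J c t : c != 1%N :> nat -> ones (put J c t) = ones t :\: J.
Proof.
by move=> c1; apply/setP=> i; rewrite !inE ffunE; case: ifP; rewrite // (negPf c1).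
Qed.

Lemma card_ones_put J c t : c != 1%N :> nat -> J \subset ones t -> J != set0 ->
  (#|ones (put J c t)| < #|ones t|)%N.
Proof.
move=> c1 Jt /set0Pn[j jJ]; rewrite ones_put //; apply: proper_card.
rewrite properEneq subsetDl andbT; apply/negP=> /eqP/setP/(_ j).
by rewrite !inE jJ /=; have := subsetP Jt j jJ; rewrite inE => ->.
Qed.
End Patterns.

Section Blocks.
Variables (p : nat) (pr_p : prime p) (d s : nat).
Local Notation F := 'F_p.

Section Basics.
Variable B : blocks p d s.
Local Notation n := (bs_n B).
Local Notation e := (bs_e B).
Local Notation Z := (bs_Z B).
Local Notation A := (bs_A B).
Local Notation lab := {ffun 'I_s -> bs_L B}.
Implicit Types (t : {ffun 'I_s -> 'I_3}) (J : {set 'I_s}) (z : lab) (v w : 'rV[F]_d).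

Definition blk t z i : 'M[F]_d :=
  match nat_of_ord (t i) with 0%N => 0 | 1%N => A i (z i) | _ => e i end.
Definition Gam t z : 'M[F]_d := (\sum_i blk t z i)%MS.
Definition dlt t : nat := (\sum_i t i * n i)%N.
Definition wgt J : nat := (\sum_(i in J) n i)%N.
(** Labels outside [ones t] do not affect [Gam t z]; pinning them to a default makes sums over valid
    labels count each choice once. For the same reason [res] resets the labels on [J]. *)
Definition valid t z : bool :=
  [forall i, if i \in ones t then z i \in Z i else z i == bs_z0 B].
Definition res J z : lab := [ffun i => if i \in J then bs_z0 B else z i].
Definition witness t z M v : bool :=
  [&& (v <= Gam t z)%MS, smallv M v & [forall (i | i \in ones t), v *m e i != 0]].
Definition rel t z M : bool := [exists v, witness t z M v].

Lemma blk_sub t z i : valid t z -> (blk t z i <= e i)%MS.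
Proof.
move=> /forallP/(_ i); rewrite /blk inE; case: (t i) => [] [|[|k]] kP //=.
  by rewrite sub0mx.
exact: bs_sub.
Qed.

Lemma mul_sub_e m (v : 'M[F]_(m, d)) i : (v <= e i)%MS -> v *m e i = v.
Proof. by case/submxP=> D ->; rewrite -mulmxA bs_idem eqxx. Qed.

Lemma mul_sub_e0 m (v : 'M[F]_(m, d)) i j : (v <= e i)%MS -> i != j -> v *m e j = 0.
Proof. by case/submxP=> D -> /negPf ij; rewrite -mulmxA bs_idem ij mulmx0. Qed.

Lemma sum_components v : v = \sum_i v *m e i.
Proof. by rewrite -mulmx_sumr bs_sum mulmx1. Qed.

(** The [e i] are orthogonal idempotents with sum 1, and each [blk t z i] lies in the image of
    [e i], so membership can be tested block by block. *)
Lemma sub_GamP t z v : valid t z ->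
  reflect (forall i, (v *m e i <= blk t z i)%MS) (v <= Gam t z)%MS.
Proof.
move=> val; apply: (iffP idP) => [/sub_sumsmxP[u ->] i|h]; last first.
  by rewrite (sum_components v) summx_sub_sums.
rewrite mulmx_suml (bigD1 i) //= big1 ?addr0 => [|j ji].
  by rewrite -mulmxA (mul_sub_e (blk_sub i val)) submxMl.
by rewrite -mulmxA (mul_sub_e0 (blk_sub j val) ji) mulmx0.
Qed.

Lemma rank_Gam t z : valid t z -> \rank (Gam t z) = dlt t.
Proof.
move=> val; have dir : mxdirect (\sum_i blk t z i).
  apply/mxdirect_sumsP => i _; apply/eqP/rowV0P => v; rewrite sub_capmx.
  case/andP=> vi /sub_sumsmxP[u vE].
  rewrite -(mul_sub_e (submx_trans vi (blk_sub i val))) {1}vE mulmx_suml big1 // => j ji.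
  by rewrite -mulmxA (mul_sub_e0 (blk_sub j val) ji) mulmx0.
rewrite /Gam (mxdirectP dir) /=; apply: eq_bigr => i _.
have := forallP val i; rewrite /blk inE; case: (t i) => [] [|[|[|]]] //= _.
- by rewrite mxrank0.
- by rewrite mul1n; apply: bs_rank_A.
- by move=> _; rewrite bs_rank_e.
Qed.

Lemma dltD_dual t : (dlt t + dlt (dualp t) = d)%N.
Proof.
rewrite (bs_dim B) -big_split /=; apply: eq_bigr => i _.
by rewrite ffunE -mulnDl; case: (t i) => [] [|[|[]]].
Qed.

Lemma dlt_put J t : J \subset ones t ->
  (dlt (put J ord0 t) + wgt J = dlt t)%N /\ (dlt (put J ord_max t) = dlt t + wgt J)%N.
Proof.
clear pr_p; move=> /subsetP Jt; rewrite /wgt big_mkcond -!big_split /=.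
split; apply: eq_bigr => i _; rewrite ffunE; case: ifP => //= [/Jt|_]; rewrite ?addn0 //.
  by rewrite inE => /eqP ->; rewrite mul1n.
by rewrite inE => /eqP ->; lia.
Qed.

Lemma valid_res J t z (c : 'I_3) : c != 1%N :> nat -> valid t z -> valid (put J c t) (res J z).
Proof.
move=> c1 /forallP val; apply/forallP=> i; have := val i.
by rewrite ones_put // in_setD ffunE; case: (i \in J) => //=; rewrite eqxx.
Qed.

Lemma valid_put J t z (c c' : 'I_3) : c != 1%N :> nat -> c' != 1%N :> nat ->
  valid (put J c t) z = valid (put J c' t) z.
Proof. by move=> c1 c1'; rewrite /valid !ones_put. Qed.

Lemma blk_put_out J t (c : 'I_3) z i : i \notin J -> blk (put J c t) (res J z) i = blk t z i.
Proof. by move=> iJ; rewrite /blk !ffunE (negPf iJ). Qed.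

Lemma rel_le t z M K : (M <= K)%N -> rel t z M -> rel t z K.
Proof.
move=> MK /existsP[v /and3P[vG sv nv]]; apply/existsP; exists v.
by rewrite /witness vG nv (smallv_le MK sv).
Qed.

Lemma rel1F t z : ones t != set0 -> ~~ rel t z 1.
Proof.
case/set0Pn=> i it; apply/existsP=> -[v /and3P[_ /(smallv1 pr_p) -> /forall_inP/(_ i it)]].
by rewrite mul0mx eqxx.
Qed.

Lemma rel_put_max J t z M : valid (put J ord0 t) z ->
  rel (put J ord0 t) z M -> rel (put J ord_max t) z M.
Proof.
move=> val /existsP[v /and3P[/sub_GamP vG sv nv]]; apply/existsP; exists v.
have nv' : [forall (i | i \in ones (put J ord_max t)), v *m e i != 0].
  by move: nv; rewrite !ones_put.
rewrite /witness sv nv' !andbT.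
have val' : valid (put J ord_max t) z by rewrite (valid_put _ _ _ (c' := ord0)).
apply/(sub_GamP _ val') => i; have := vG val i; rewrite /blk !ffunE.
by case: (i \in J) => //= _; apply: submxMl.
Qed.

(* [J] is the zero set of a typical small vector. *)
Lemma majority t z M : valid t z -> (0 < M)%N ->
  exists J : {set 'I_s}, [/\ J \subset ones t,
    (cnt M (Gam t z) <= 2 ^ s * cnt M (Gam (put J ord0 t) (res J z)))%N,
    rel (put J ord0 t) (res J z) M & ~~ rel t z M -> J != set0].
Proof.
move=> val M0.
(* Pigeonhole over the [2 ^ s] possible zero sets. *)
pose zero v : {set 'I_s} := [set i in ones t | v *m e i == 0].
pose X : {set 'rV[F]_d} := [set v | (v <= Gam t z)%MS && smallv M v].
pose fib J := [set v in X | zero v == J].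
have [J _ Jmax] := @arg_maxnP _ (set0 : {set 'I_s}) predT (fun J => #|fib J|) isT.
have Xle : (#|X| <= 2 ^ s * #|fib J|)%N.
  have -> : (2 ^ s = #|{: {set 'I_s}}|)%N by rewrite -cardsT -powersetT card_powerset cardsT card_ord.
  by apply: (card_le_fibresT (f := zero)) => K; apply: (Jmax K).
have : (0 < #|fib J|)%N.
  rewrite lt0n; apply: contraTneq (cnt_gt0 pr_p (Gam t z) M0) => f0; rewrite -leqNgt.
  by apply: leq_trans Xle _; rewrite f0 muln0.
case/card_gt0P=> v vfib; move: (vfib); rewrite !inE => /andP[/andP[/sub_GamP vG sv] /eqP vJ].
have Jt : J \subset ones t by rewrite -vJ; apply/subsetP=> i; rewrite inE => /andP[].
have val0 : valid (put J ord0 t) (res J z) by apply: valid_res.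
have sub w : w \in fib J -> (w <= Gam (put J ord0 t) (res J z))%MS.
  rewrite !inE => /andP[/andP[/sub_GamP wG _] /eqP wJ]; apply/sub_GamP=> // i.
  have [iJ|iJ] := boolP (i \in J); last by rewrite blk_put_out //; apply: wG.
  by move: iJ; rewrite -wJ inE => /andP[_ /eqP ->]; rewrite sub0mx.
exists J; split=> //.
- apply: leq_trans Xle _; rewrite leq_mul2l; apply/orP; right.
  apply/subset_leq_card/subsetP=> w wJ; rewrite inE sub //=.
  by move: wJ; rewrite !inE => /andP[/andP[]].
- apply/existsP; exists v; rewrite /witness sub //.
  rewrite sv ones_put //=; apply/forall_inP=> i; rewrite inE => /andP[iJ it].
  by move: iJ; rewrite -vJ inE it.
(* If [J] were empty, [v] would itself witness the relevance of [z] at scale [M]. *)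
- move=> nrel; apply/negP=> /eqP J0; case/negP: nrel; apply/existsP; exists v.
  apply/and3P; split=> //; first by apply/(sub_GamP _ val); apply: vG.
  apply/forall_inP=> i it; apply/negP=> vi.
  by have := in_set0 i; rewrite -J0 -vJ inE it vi.
Qed.

(** Add to each small vector for [put J ord0 t] a witness of each label of the fibre. On [J] the sum
    keeps the components of the witness, which are nonzero and so, by the spread property, determine
    the label; off [J] all labels agree with [zeta]. Hence the sums are distinct, and they lie in
    the subspace with the blocks of [J] full. *)
Lemma fibre_count J t (zeta : lab) h h' : J \subset ones t -> valid (put J ord0 t) zeta ->
  (#|[set z | [&& valid t z, res J z == zeta & rel t z h']]|
     * cnt h (Gam (put J ord0 t) zeta) <= cnt (h' + h) (Gam (put J ord_max t) zeta))%N.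
Proof.
move=> Jt val0; set Zs := [set z | _].
pose X : {set 'rV[F]_d} := [set v | (v <= Gam (put J ord0 t) zeta)%MS && smallv h v].
have val2 : valid (put J ord_max t) zeta by rewrite (valid_put _ _ _ (c' := ord0)).
pose wit z : 'rV[F]_d := odflt 0 [pick v | witness t z h' v].
have witP z : rel t z h' -> witness t z h' (wit z).
  by rewrite /wit; case: pickP => // w0 /existsP[v]; rewrite w0.
have ZsP z : z \in Zs -> [/\ valid t z, res J z = zeta & witness t z h' (wit z)].
  by rewrite inE => /and3P[vz /eqP rz /witP].
have XP w : w \in X -> [/\ (w <= Gam (put J ord0 t) zeta)%MS, smallv h w &
    forall i, i \in J -> w *m e i = 0].
  rewrite inE => /andP[wG sw]; split=> // i iJ; move/sub_GamP: wG => /(_ val0 i).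
  by rewrite /blk ffunE iJ submx0 => /eqP.
rewrite -cardsX -(card_in_imset (f := fun zw : lab * 'rV[F]_d => wit zw.1 + zw.2)).
  apply/subset_leq_card/subsetP=> _ /imsetP[[z w] /setXP[/= /ZsP[vz rz /and3P[zG sz _]] /XP[wG sw _]] ->].
  rewrite inE smallvD // andbT; apply/sub_GamP=> // i.
  have [iJ|iJ] := boolP (i \in J); first by rewrite /blk ffunE iJ submxMl.
  rewrite -rz blk_put_out // mulmxDl addmx_sub //; first exact: (sub_GamP _ vz zG).
  by move/sub_GamP: wG => /(_ val0 i); rewrite -rz blk_put_out.
move=> [z w] [z' w'] /setXP[/= /ZsP[vz rz /and3P[zG sz nz]] /XP[wG sw w0]].
move=> /setXP[/= /ZsP[vz' rz' /and3P[zG' sz' nz']] /XP[wG' sw' w0']] eq.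
suff zz' : z = z' by move: eq; rewrite zz' => /addrI ->.
apply/ffunP=> i; have [iJ|iJ] := boolP (i \in J); last first.
  by have := congr1 (fun f : lab => f i) rz'; rewrite -rz !ffunE (negPf iJ).
have it := subsetP Jt i iJ.
have ei : wit z *m e i = wit z' *m e i.
  by have := congr1 (mulmx^~ (e i)) eq; rewrite !mulmxDl w0 // w0' // !addr0.
have t1 : t i = 1%N :> nat by move: it; rewrite inE => /eqP.
have inZ y : valid t y -> y i \in Z i by move=> /forallP/(_ i); rewrite it.
apply/eqP; apply: contraNT (forall_inP nz i it) => ne; apply/eqP.
apply: (bs_spread (inZ _ vz) (inZ _ vz') ne).
  by have := sub_GamP _ vz zG i; rewrite /blk t1.
by rewrite ei; have := sub_GamP _ vz' zG' i; rewrite /blk t1.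
Qed.

Lemma fibre_total J t (zeta : lab) : J \subset ones t ->
  (#|[set z | valid t z && (res J z == zeta)]| <= 2 ^ s * p ^ wgt J)%N.
Proof.
move=> Jt; pose P i : {set bs_L B} := if i \in J then Z i else [set zeta i].
apply: leq_trans (_ : #|family P| <= _)%N.
  apply/subset_leq_card/subsetP=> z; rewrite inE => /andP[vz /eqP rz].
  apply/familyP=> i; rewrite /P; case: ifP => iJ.
    by have := forallP vz i; rewrite (subsetP Jt).
  by rewrite inE -rz ffunE iJ.
rewrite card_family foldrE big_map big_enum /=.
have -> : (2 ^ s = \prod_(i < s) 2)%N by rewrite prod_nat_const card_ord.
rewrite /wgt expn_sum (big_mkcond (mem J)) -big_split /=; apply: leq_prod => i _.
by rewrite /P; case: ifP => _; [apply: bs_card | rewrite cards1].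
Qed.

End Basics.

(** * The dual system: annihilators of the spread inside each block *)

Definition dual_A (B : blocks p d s) i (z : bs_L B) : 'M[F]_d :=
  ((bs_e B i)^T :&: kermx (bs_A B i z)^T)%MS.

Lemma dual_idem (B : blocks p d s) i j :
  (bs_e B i)^T *m (bs_e B j)^T = if i == j then (bs_e B i)^T else 0.
Proof.
by rewrite -trmx_mul bs_idem eq_sym; case: eqVneq => [->|]; rewrite ?trmx0.
Qed.

Lemma dual_sum (B : blocks p d s) : \sum_i (bs_e B i)^T = 1%:M.
Proof. by rewrite -(linear_sum (@trmx _ _ _)) /= bs_sum trmx1. Qed.

Lemma dual_rank_e (B : blocks p d s) i : \rank (bs_e B i)^T = (2 * bs_n B i)%N.
Proof. by rewrite mxrank_tr bs_rank_e. Qed.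

Lemma dual_sub (B : blocks p d s) i z : z \in bs_Z B i -> (dual_A i z <= (bs_e B i)^T)%MS.
Proof. by move=> _; apply: capmxSl. Qed.

Lemma dual_rank_A (B : blocks p d s) i z : z \in bs_Z B i -> \rank (dual_A i z) = bs_n B i.
Proof.
clear pr_p; move=> zZ; have := mxrank_mul_ker (bs_e B i)^T (bs_A B i z)^T.
rewrite -trmx_mul (mul_sub_e (bs_sub zZ)) !mxrank_tr bs_rank_e (bs_rank_A zZ).
by rewrite /dual_A; lia.
Qed.

(** Two distinct members of the spread meet in zero and have half the dimension of the block, so
    they span it; a vector annihilating both annihilates the block. *)
Lemma dual_spread (B : blocks p d s) i z z' (v : 'rV[F]_d) : z \in bs_Z B i -> z' \in bs_Z B i ->
  z != z' -> (v <= dual_A i z)%MS -> (v <= dual_A i z')%MS -> v = 0.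
Proof.
clear pr_p; move=> zZ zZ' ne; rewrite !sub_capmx => /andP[ve /sub_kermxP vz] /andP[_ /sub_kermxP vz'].
have cap0 : (bs_A B i z :&: bs_A B i z')%MS = 0.
  apply/eqP/rowV0P=> w; rewrite sub_capmx => /andP[wz wz'].
  exact: (bs_spread zZ zZ' ne wz wz').
have le : (bs_A B i z + bs_A B i z' <= bs_e B i)%MS by rewrite addsmx_sub !bs_sub.
have : (bs_e B i <= bs_A B i z + bs_A B i z')%MS.
  rewrite -(geq_leqif (mxrank_leqif_sup le)) mxrank_disjoint_sum // bs_rank_e.
  by rewrite !bs_rank_A //; lia.
case/sub_addsmxP=> [[P Q] /= eE].
have -> : v = v *m (bs_e B i)^T.
  by case/submxP: ve => D ->; rewrite -mulmxA dual_idem eqxx.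
by rewrite eE linearD /= !trmx_mul mulmxDr !mulmxA vz vz' !mul0mx addr0.
Qed.

Definition dual (B : blocks p d s) : blocks p d s :=
  Blocks (bs_z0 B) (@bs_n_gt0 _ _ _ B) (bs_dim B) (@dual_idem B) (dual_sum B)
    (@dual_rank_e B) (@dual_sub B) (@dual_rank_A B) (@dual_spread B) (@bs_card _ _ _ B).

Lemma valid_dual (B : blocks p d s) t (z : {ffun 'I_s -> bs_L B}) :
  valid (B := dual B) (dualp t) z = valid t z.
Proof. by rewrite /valid ones_dualp. Qed.

Lemma Gam_dual (B : blocks p d s) t (z : {ffun 'I_s -> bs_L B}) : valid t z ->
  Gam t z *m (Gam (B := dual B) (dualp t) z)^T = 0.
Proof.
move=> val; have val' : valid (B := dual B) (dualp t) z by rewrite valid_dual.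
apply/matrixP=> a b; set G := Gam t z; set G' := Gam _ _.
transitivity ((row a G *m (row b G')^T) 0 0).
  by rewrite !mxE; apply: eq_bigr => k _; rewrite !mxE.
have va := sub_GamP _ val (row_sub a G).
have vb := sub_GamP _ val' (row_sub b G').
move: (row a G) (row b G') va vb => v w va vb.
rewrite {1}(sum_components B v) mulmx_suml summxE big1 ?mxE // => i _.
have -> : v *m bs_e B i *m w^T = (v *m bs_e B i) *m (w *m (bs_e B i)^T)^T.
  by rewrite trmx_mul trmxK mulmxA -[in RHS](mulmxA v) bs_idem eqxx.
have := va i; have := vb i; rewrite /blk /= ffunE /=.
case: (t i) => [] [|[|[|]]] //= _.
- by move=> _; rewrite submx0 => /eqP ->; rewrite mul0mx mxE.
- rewrite sub_capmx => /andP[_ /sub_kermxP wA] /submxP[D ->].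
  by rewrite -mulmxA -[bs_A _ _ _ *m _]trmxK trmx_mul trmxK wA trmx0 mulmx0 mxE.
- by rewrite submx0 => /eqP ->; rewrite trmx0 mulmx0 mxE.
Qed.

End Blocks.

(** * The second moment of normalised counts *)

Lemma frac_le (a b c x y : nat) : (0 < x)%N -> (0 < y)%N -> (a * x <= c * y * b)%N ->
  a%:R / y%:R <= c%:R * (b%:R / x%:R) :> rat.
Proof.
move=> x0 y0 le; rewrite mulrA ler_pdivrMr ?ltr0n // mulrAC.
by rewrite ler_pdivlMr ?ltr0n // -!natrM ler_nat [X in (_ <= X)%N]mulnAC.
Qed.

Lemma ler_sum_term (R : numDomainType) (I : finType) (P : pred I) (f : I -> R) (i : I) :
  P i -> (forall j, 0 <= f j) -> f i <= \sum_(j | P j) f j.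
Proof. by move=> Pi f0; rewrite (bigD1 i) //= lerDl sumr_ge0. Qed.

(** Here [h] and [M] stand for scales of order [sqrt q]. After squaring, each [h ^ 2] is bounded
    below by [q / D] and each [M ^ 2] above by [16 * q]; the powers of [q] cancel except for
    [q ^ m]. *)
Lemma transfer_back (y w c D q h M : rat) (a b m : nat) :
  0 <= y -> 0 <= w -> 0 < q -> 0 < h -> 0 <= M -> 0 <= c -> 0 <= D ->
  y * h ^+ (2 * a + b + m) <= c * q ^+ a * M ^+ b * w ->
  M ^+ 2 <= 16 * q -> q <= D * h ^+ 2 ->
  y ^+ 2 * q ^+ m <= c ^+ 2 * 16 ^+ b * D ^+ (2 * a + b + m) * w ^+ 2.
Proof.
move=> y0 w0 q0 h0 M0 c0 D0 le Mq qD; set E := (2 * a + b + m)%N in le *.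
have q0' := ltW q0; have h0' := ltW h0.
have sq : y ^+ 2 * (h ^+ 2) ^+ E <= c ^+ 2 * q ^+ (2 * a) * (16 * q) ^+ b * w ^+ 2.
  have : (y * h ^+ E) ^+ 2 <= (c * q ^+ a * M ^+ b * w) ^+ 2.
    by rewrite ler_sqr // nnegrE ?mulr_ge0 ?exprn_ge0.
  have -> : (y * h ^+ E) ^+ 2 = y ^+ 2 * (h ^+ 2) ^+ E by rewrite exprMn exprAC.
  move=> /le_trans; apply.
  have -> : (c * q ^+ a * M ^+ b * w) ^+ 2 = c ^+ 2 * q ^+ (2 * a) * (M ^+ 2) ^+ b * w ^+ 2.
    by rewrite 3!exprMn [(M ^+ 2) ^+ b]exprAC -[(q ^+ a) ^+ 2]exprM [(a * 2)%N]mulnC.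
  by rewrite ler_wpM2r ?ler_wpM2l ?lerXn2r ?nnegrE ?mulr_ge0 ?exprn_ge0.
rewrite -(ler_pM2r (exprn_gt0 (2 * a + b) q0)).
have -> : y ^+ 2 * q ^+ m * q ^+ (2 * a + b) = y ^+ 2 * q ^+ E.
  by rewrite -mulrA -exprD [(m + _)%N]addnC.
apply: le_trans (_ : y ^+ 2 * (D * h ^+ 2) ^+ E <= _).
  by rewrite ler_wpM2l ?lerXn2r ?nnegrE ?mulr_ge0 ?exprn_ge0.
have -> : y ^+ 2 * (D * h ^+ 2) ^+ E = D ^+ E * (y ^+ 2 * (h ^+ 2) ^+ E).
  by rewrite [(D * _) ^+ E]exprMn mulrCA.
apply: le_trans (ler_wpM2l (exprn_ge0 _ D0) sq) _.
by apply: ler_eq; rewrite exprMn [q ^+ (2 * a + b)]exprD; ring.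
Qed.

(** In the application [a] and [b] are the dimensions for a pattern and its dual, [m] is the weight
    of [J], [v] the dimension with [J] full, and [u] the dual one with [J] zero. *)
Lemma dual_exponents (u v m a b d : nat) : (v = a + m)%N -> (u + m = b)%N -> (a + b = d)%N ->
  [/\ (u + v = d)%N, (2 * u + v + m = b + d)%N, (2 * u + v + m <= 2 * d)%N & (v <= 2 * d)%N].
Proof. by split; lia. Qed.

Lemma step_arith (d s : nat) (c K L : rat) : 0 <= c -> 0 <= K -> 1 <= L -> (s <= d)%N ->
  c * (2 ^+ s * L * (2 * 7 ^+ d * K) + 2 ^+ s * L * (2 * 7 ^+ d * K) + 2 ^+ s * (2 ^+ s * K))
  <= c * 5 * 14 ^+ d * 2 ^+ d * L * K.
Proof.
move=> c0 K0 L1 sd.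
have x0 : 0 <= (2 : rat) ^+ s by rewrite exprn_ge0.
have xX : (2 : rat) ^+ s <= 2 ^+ d by rewrite ler_weXn2l //; lra.
have X1 : 1 <= (2 : rat) ^+ d by rewrite exprn_ege1 //; lra.
have w1 : 1 <= (7 : rat) ^+ d by rewrite exprn_ege1 //; lra.
have -> : (14 : rat) ^+ d = 2 ^+ d * 7 ^+ d by rewrite -exprMn; congr (_ ^+ _); ring.
move: ((2 : rat) ^+ s) ((2 : rat) ^+ d) ((7 : rat) ^+ d) x0 xX X1 w1 => x X w x0 xX X1 w1.
have w0 : 0 <= w by lra.
have L0 : 0 <= L by lra.
have X0 : 0 <= X by lra.
have wLK : 0 <= w * L * K by rewrite !mulr_ge0.
have K1 : K <= w * L * K.
  rewrite -[leLHS]mul1r ler_wpM2r //; apply: le_trans w1 _.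
  by rewrite -[leLHS]mulr1 ler_wpM2l.
have xXX : x <= X * X by apply: le_trans xX _; rewrite -[leLHS]mul1r ler_wpM2r.
have y1 : x * (w * L * K) <= X * X * (w * L * K) by rewrite ler_wpM2r.
have y2 : x * x * K <= X * X * (w * L * K) by apply: ler_pM; rewrite ?mulr_ge0 // ler_pM.
have -> : c * (x * L * (2 * w * K) + x * L * (2 * w * K) + x * (x * K)) =
  c * (4 * (x * (w * L * K)) + x * x * K) by ring.
have -> : c * 5 * (X * w) * X * L * K = c * (5 * (X * X * (w * L * K))) by ring.
by rewrite ler_wpM2l //; lra.
Qed.

Section Moments.
Variables (p : nat) (pr_p : prime p) (d s : nat).
Local Notation F := 'F_p.

Section Sums.
Variable B : blocks p d s.
Local Notation lab := {ffun 'I_s -> bs_L B}.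
Implicit Types (t : {ffun 'I_s -> 'I_3}) (J : {set 'I_s}) (z : lab).

Definition ncnt t z M : rat := (cnt M (Gam t z))%:R / M%:R ^+ dlt B t.

(** Relevance is built into the sum: otherwise every valid label would contribute 1 at scale 1. *)
Definition moment t M : rat := \sum_(z : lab | valid t z && rel t z M) ncnt t z M ^+ 2.

(** The normalisation is that of [t], not of the smaller pattern; it is the geometric mean of those
    for [J] zero and [J] full. *)
Definition rcnt t z J M : rat :=
  (cnt M (Gam (put J ord0 t) (res J z)))%:R / M%:R ^+ dlt B t.

Lemma s_le_d : (s <= d)%N.
Proof.
clear pr_p; rewrite (bs_dim B) -[X in (X <= _)%N]card_ord -sum1_card; apply: leq_sum => i _.
by have := bs_n_gt0 B i; lia.
Qed.

Lemma dlt_le t : (dlt B t <= d)%N.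
Proof. by rewrite -[X in (_ <= X)%N](dltD_dual B t) leq_addr. Qed.

Lemma wgt_le J : (wgt B J <= d)%N.
Proof.
clear pr_p; apply: leq_trans (_ : \sum_i 2 * bs_n B i <= _)%N; last by rewrite -(bs_dim B).
by rewrite /wgt big_mkcond; apply: leq_sum => i _; case: ifP => _; lia.
Qed.

Lemma ncnt_ge0 t z M : 0 <= ncnt t z M.
Proof. by rewrite divr_ge0 ?exprn_ge0. Qed.

Lemma rcnt_ge0 t z J M : 0 <= rcnt t z J M.
Proof. by rewrite divr_ge0 ?exprn_ge0. Qed.

Lemma ncnt_le_trivial t z M : valid t z -> (0 < M)%N -> ncnt t z M <= 2 ^+ d.
Proof.
move=> vz M0; rewrite ler_pdivrMr ?exprn_gt0 ?ltr0n //.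
apply: le_trans (_ : ((2 * M) ^ dlt B t)%:R <= _).
  by rewrite ler_nat -(rank_Gam vz) cnt_le_rank.
rewrite natrX natrM exprMn ler_wpM2r ?exprn_ge0 // ler_weXn2l ?dlt_le //; lra.
Qed.

(** There are at most [2 ^ s * p ^ wgt] valid labels, each contributing at most [4 ^ d]. This serves
    for patterns without ones and for [p] small in terms of [d]. *)
Lemma moment_le_trivial t M : (0 < M)%N ->
  moment t M <= 8 ^+ d * p%:R ^+ wgt B (ones t).
Proof.
move=> M0; apply: le_trans (_ : \sum_(z : lab | valid t z) 4 ^+ d <= _).
  rewrite /moment big_mkcondr; apply: ler_sum => z vz; case: ifP => _; last first.
    by rewrite exprn_ge0.
  have -> : (4 : rat) = 2 ^+ 2 by ring.
  rewrite -exprM mulnC exprM ler_sqr ?nnegrE ?ncnt_ge0 ?exprn_ge0 //.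
  exact: ncnt_le_trivial.
rewrite sumr_const.
have : (#|[pred z : lab | valid t z]| <= 2 ^ s * p ^ wgt B (ones t))%N.
  apply: leq_trans (fibre_total [ffun _ => bs_z0 B] (subxx (ones t))).
  apply/subset_leq_card/subsetP=> z; rewrite !inE => vz; rewrite vz /=.
  apply/eqP/ffunP=> i; rewrite !ffunE; have := forallP vz i.
  by case: ifP => // _ /eqP.
set m := #|_| => mle; rewrite -[_ *+ m]mulr_natl.
apply: le_trans (_ : (2 ^ s * p ^ wgt B (ones t))%:R * 4 ^+ d <= _).
  by rewrite ler_wpM2r ?exprn_ge0 // ler_nat.
have -> : (8 : rat) = 2 * 4 by ring.
rewrite natrM !natrX exprMn mulrAC ler_wpM2r ?exprn_ge0 // ler_wpM2r ?exprn_ge0 //.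
by rewrite ler_weXn2l ?s_le_d //; lra.
Qed.

Lemma sum_fibres t J (c : 'I_3) (P Q : pred lab) (f : lab -> rat) : c != 1%N :> nat ->
  \sum_(z | [&& valid t z, P z & Q (res J z)]) f (res J z) =
  \sum_(zeta | valid (put J c t) zeta && Q zeta)
    #|[set z | [&& valid t z, res J z == zeta & P z]]|%:R * f zeta.
Proof.
move=> c1.
rewrite (partition_big (res J) (fun zeta => valid (put J c t) zeta && Q zeta)) /=; last first.
  by move=> z /and3P[vz _ ->]; rewrite valid_res.
apply: eq_bigr => zeta /andP[vz Qz].
transitivity (\sum_(z in [set z | [&& valid t z, res J z == zeta & P z]]) f zeta).
  apply: eq_big => [z|z /andP[_ /eqP ->]] //; rewrite inE.
  by case: eqP => [->|]; rewrite ?Qz ?andbT ?andbF //.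
by rewrite sumr_const mulr_natl.
Qed.

(* [2 ^ j.+1] is the first scale at which [z] is relevant. *)
Lemma descend t z b : valid t z -> ones t != set0 -> rel t z (2 ^ b) ->
  exists j J, [/\ (j < b)%N, J \subset ones t, J != set0 &
    [&& valid t z, rel t z (2 ^ j.+1) & rel (put J ord0 t) (res J z) (2 ^ j)]] /\
    ncnt t z (2 ^ j) <= 2 ^+ s * rcnt t z J (2 ^ j).
Proof.
move=> vz t0 rz.
have ex : exists m, rel t z (2 ^ m) by exists b.
have [m rm mmin] := ex_minnP ex.
case: m rm mmin => [|j] rm mmin; first by rewrite (negPf (rel1F pr_p z t0)) in rm.
have nr : ~~ rel t z (2 ^ j) by apply/negP=> /mmin; rewrite ltnn.
have h0 : (0 < 2 ^ j)%N by rewrite expn_gt0.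
have [J [Jt le rJ J0]] := majority pr_p vz h0.
exists j, J; split; first by split; rewrite ?mmin ?J0 // vz rm rJ.
rewrite /ncnt /rcnt mulrA ler_wpM2r ?invr_ge0 ?exprn_ge0 //.
by rewrite -natrX -natrM ler_nat.
Qed.

Lemma rel_res t z J M : valid t z -> J \subset ones t ->
  rel t z M -> rel (put J ord_max t) (res J z) M.
Proof.
move=> vz Jt /existsP[v /and3P[vG sv nv]]; apply/existsP; exists v; apply/and3P; split=> //.
  apply/(sub_GamP _ (valid_res _ _ vz)) => // i.
  have [iJ|iJ] := boolP (i \in J); first by rewrite /blk ffunE iJ submxMl.
  by rewrite blk_put_out //; apply: (sub_GamP _ vz vG).
rewrite ones_put //; apply/forall_inP=> i; rewrite inE => /andP[_]; exact: (forall_inP nv).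
Qed.

End Sums.

(** * Sums over labels bounded by the induction hypothesis *)

Section Step.
Variables (k : nat) (Kb : rat).
Hypothesis IH : forall (B : blocks p d s) t a, (#|ones t| <= k)%N ->
  ((2 ^ a) ^ 2 <= 16 * p)%N -> moment B t (2 ^ a) <= Kb.

Section Fixed.
Variables (B : blocks p d s) (t : {ffun 'I_s -> 'I_3}).
Local Notation lab := {ffun 'I_s -> bs_L B}.
Implicit Types (J : {set 'I_s}) (z : lab).
Hypothesis tk : (#|ones t| <= k.+1)%N.

Definition good J := (J \subset ones t) && (J != set0).

Lemma good_put J (c : 'I_3) : good J -> c != 1%N :> nat -> (#|ones (put J c t)| <= k)%N.
Proof.
by case/andP=> Jt J0 c1; rewrite -ltnS; apply: leq_trans tk; apply: card_ones_put.
Qed.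

(** Group the labels by [zeta = res J z]. By [fibre_count], the fibre size times the count with [J]
    zero is at most a constant times the count with [J] full, so a fibre contributes at most
    [7 ^ d * x * y] for the normalised counts [x], [y] of the two smaller patterns, and
    [x * y <= x ^ 2 + y ^ 2]. *)
Lemma sum_rcnt J j : good J -> ((2 ^ j) ^ 2 <= 16 * p)%N ->
  \sum_(z : lab | [&& valid t z, rel t z (2 ^ j.+1) & rel (put J ord0 t) (res J z) (2 ^ j)])
    rcnt t z J (2 ^ j) ^+ 2 <= 2 * 7 ^+ d * Kb.
Proof.
move=> gJ jp; have /andP[Jt J0] := gJ.
have [d0 d2] := dlt_put B Jt.
set h := (2 ^ j)%N; have h0 : (0 < h)%N by rewrite expn_gt0.
have hr : 0 < (h%:R : rat) by rewrite ltr0n.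
rewrite /rcnt (@sum_fibres B t J ord0 (fun z => rel t z (2 ^ j.+1))
  (fun zeta => rel (put J ord0 t) zeta h)
  (fun zeta => ((cnt h (Gam (put J ord0 t) zeta))%:R / h%:R ^+ dlt B t) ^+ 2)) //.
apply: le_trans (_ : \sum_(zeta : lab | valid (put J ord0 t) zeta && rel (put J ord0 t) zeta h)
  7 ^+ d * (ncnt (put J ord0 t) zeta h ^+ 2 + ncnt (put J ord_max t) zeta h ^+ 2) <= _).
  apply: ler_sum => zeta /andP[vz rz].
  set m := #|_|; set a := cnt h _; rewrite /ncnt -/a; set b := cnt h _.
  (* The scales [2h] of the witnesses and [h] of the small vectors add up to [3h]; returning to [h]
     costs [7 ^ d]. *)
  have mab : (m * a <= 7 ^ d * b)%N.
    apply: leq_trans (fibre_count pr_p h (2 ^ j.+1) Jt vz) _.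
    have -> : (2 ^ j.+1 + h = 3 * h)%N by rewrite expnS -/h; lia.
    exact: cnt_mulr.
  pose x : rat := a%:R / h%:R ^+ dlt B (put J ord0 t).
  pose y : rat := b%:R / h%:R ^+ dlt B (put J ord_max t).
  have x0 : 0 <= x by rewrite divr_ge0 ?exprn_ge0.
  have y0 : 0 <= y by rewrite divr_ge0 ?exprn_ge0.
  apply: le_trans (_ : 7 ^+ d * (x * y) <= _).
    have hE : h%:R ^+ dlt B (put J ord0 t) * h%:R ^+ dlt B (put J ord_max t) =
       (h%:R ^+ dlt B t) ^+ 2 :> rat.
      by rewrite -exprD -exprM; congr (_ ^+ _); lia.
    have -> : x * y = a%:R * b%:R / (h%:R ^+ dlt B t) ^+ 2.
      by rewrite /x /y mulrACA -invfM hE.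
    rewrite expr_div_n !mulrA ler_pM2r ?invr_gt0 ?exprn_gt0 //.
    have -> : m%:R * a%:R * a%:R = a%:R * (m * a)%:R :> rat by rewrite natrM; ring.
    have -> : 7 ^+ d * a%:R * b%:R = a%:R * (7 ^ d * b)%:R :> rat by rewrite natrM natrX; ring.
    by rewrite ler_wpM2l // ler_nat.
  rewrite ler_wpM2l ?exprn_ge0 // -/x -/y.
  have : 0 <= (x - y) ^+ 2 by apply: sqr_ge0.
  have : 0 <= x * y by apply: mulr_ge0.
  by rewrite sqrrB; lra.
rewrite -mulr_sumr big_split /= mulrAC -mulrA [Kb * _]mulrC mulrCA ler_wpM2l ?exprn_ge0 //.
have i1 := IH B (t := put J ord0 t) (a := j) (good_put (c := ord0) gJ isT) jp.
have i2 := IH B (t := put J ord_max t) (a := j) (good_put (c := ord_max) gJ isT) jp.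
have -> : 2 * Kb = Kb + Kb by ring.
apply: lerD; first exact: i1.
apply: le_trans i2; rewrite /moment [leRHS]big_mkcond [leLHS]big_mkcond.
apply: ler_sum => zeta _; rewrite (valid_put _ _ _ (c := ord0) (c' := ord_max)) //.
case: ifP => [/andP[vz rz]|_]; last by case: ifP => _; rewrite ?sqr_ge0.
by rewrite vz rel_put_max // (valid_put _ _ _ (c' := ord_max)).
Qed.

(** Each fibre of [res J] has at most [2 ^ s * p ^ wgt B J] labels, which the division by
    [p ^ wgt B J] absorbs. *)
Lemma sum_back J b : good J -> ((2 ^ b) ^ 2 <= 16 * p)%N ->
  \sum_(z : lab | valid t z && rel (put J ord_max t) (res J z) (2 ^ b))
    ncnt (put J ord_max t) (res J z) (2 ^ b) ^+ 2 / p%:R ^+ wgt B J <= 2 ^+ s * Kb.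
Proof.
move=> gJ bp; have /andP[Jt J0] := gJ.
have pr : 0 < (p%:R : rat) ^+ wgt B J by rewrite exprn_gt0 // ltr0n prime_gt0.
have := @sum_fibres B t J ord_max predT (fun zeta => rel (put J ord_max t) zeta (2 ^ b))
  (fun zeta => ncnt (put J ord_max t) zeta (2 ^ b) ^+ 2 / p%:R ^+ wgt B J) isT.
rewrite /= => ->.
apply: le_trans (_ : \sum_(zeta : lab | valid (put J ord_max t) zeta &&
  rel (put J ord_max t) zeta (2 ^ b)) 2 ^+ s * ncnt (put J ord_max t) zeta (2 ^ b) ^+ 2 <= _).
  apply: ler_sum => zeta _; rewrite mulrCA [leRHS]mulrC ler_wpM2l ?sqr_ge0 //.
  rewrite ler_pdivrMr // -!natrX -natrM ler_nat.
  apply: leq_trans (fibre_total zeta Jt); apply/subset_leq_card/subsetP=> z.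
  by rewrite !inE andbT.
rewrite -mulr_sumr ler_wpM2l ?exprn_ge0 //.
exact: (IH B (t := put J ord_max t) (a := b) (good_put (c := ord_max) gJ isT) bp).
Qed.
End Fixed.
End Step.

(** * Charging each relevant label to a smaller pattern *)

Definition slope_const : nat := (8 * (3 ^ d * (2 * d).+1 ^ d) * (16 * d) ^ d)%N.

(* [K] is the dual scale [p / (8 d H)]. *)
Lemma slope_or_dual (B : blocks p d s) t (z : {ffun 'I_s -> bs_L B}) (H K : nat) :
  valid t z -> (0 < d)%N -> (0 < H)%N -> (0 < K)%N ->
  (8 * (d * H * K) <= p)%N -> (p <= 16 * d * (H * K))%N ->
  (forall h, (0 < h <= H)%N -> ncnt t z H <= slope_const%:R * ncnt t z h) \/
  (forall h, (0 < h <= K)%N ->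
    ncnt t z H <= slope_const%:R * ncnt (B := dual B) (dualp t) z h).
Proof.
move=> vz d0 H0 K0 HKp pHK.
have vz' : valid (B := dual B) (dualp t) z by rewrite valid_dual.
set G := Gam t z; set G' := Gam (B := dual B) (dualp t) z.
have GG' : G *m G'^T = 0 by apply: Gam_dual.
have rG : \rank G = dlt B t by apply: rank_Gam.
have rG' : \rank G' = dlt B (dualp t) by apply: (rank_Gam vz').
have dd := dltD_dual B t; set r := dlt B t in rG dd *; set r' := dlt B (dualp t) in rG' dd *.
pose c0 := (3 ^ d * (2 * d).+1 ^ d)%N.
have dHK : (d * H * K <= p)%N by apply: leq_trans HKp; rewrite leq_pmull.
have d16 : (0 < (16 * d) ^ d)%N by rewrite expn_gt0 muln_gt0 d0.
case: (slope_dichotomy pr_p GG' dHK dd) => le; [left|right] => h hH; have /andP[h0 _] := hH.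
  rewrite /ncnt -!natrX; apply: frac_le; rewrite ?expn_gt0 ?h0 ?H0 //.
  apply: leq_trans (le h hH) _; rewrite -/c0 -/G -/r.
  have c0s : (c0 <= slope_const)%N.
    by rewrite /slope_const -/c0 -mulnA mulnCA leq_pmulr // muln_gt0 d16.
  by rewrite !leq_mul2r c0s !orbT.
rewrite /ncnt -!natrX -/G -/G' -/r -/r'; apply: frac_le; rewrite ?expn_gt0 ?h0 ?H0 //.
(* Duality bounds the count of [G] at [H] by that of [G'] at [K]; as [p] is of order [H * K], the
   factor [p ^ r / K ^ d] matches the two normalisations up to a constant. *)
have du : (cnt H G * K ^ d <= 8 * p ^ r * cnt K G')%N.
  by rewrite -rG; apply: cnt_duality => //; rewrite rG rG'.
have pr' : (p ^ r <= (16 * d) ^ d * (H ^ r * K ^ r))%N.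
  apply: leq_trans (leq_expn2r r pHK) _; rewrite (expnMn (16 * d)) (expnMn H).
  by apply: leq_mul => //; apply: leq_pexp2l; [rewrite muln_gt0 d0 | apply: dlt_le].
have Kpos : (0 < K ^ d)%N by rewrite expn_gt0 K0.
rewrite -(leq_pmul2r Kpos).
have {}le := le h hH; rewrite -/c0 in le.
have Kd : (K ^ d = K ^ r * K ^ r')%N by rewrite -expnD dd.
apply: leq_trans (_ : 8 * p ^ r * (cnt K G' * h ^ r') <= _)%N.
  by rewrite mulnAC mulnA leq_mul2r du orbT.
apply: leq_trans (leq_mul (leq_mul (leqnn 8) pr') le) _.
rewrite Kd /slope_const -/c0; apply/eq_leq; ring.
Qed.

Definition charge_const : nat :=
  ((slope_const * 2 ^ d * 8) ^ 2 * 16 ^ (2 * d) * ((128 * d) ^ 2) ^ (2 * d))%N.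

(** [2 ^ c] is of order [sqrt p / d]. The three cases are: a slope bound for [Gam] and descent in
    the scale; a slope bound for the dual, relevant at [2 ^ c], and descent there; the dual not
    relevant at [2 ^ c], and transfer of its count back by duality. *)
Lemma charge (B : blocks p d s) t (z : {ffun 'I_s -> bs_L B}) (a c : nat) :
  (0 < d)%N -> valid t z -> ones t != set0 -> rel t z (2 ^ a) ->
  ((2 ^ a) ^ 2 <= 16 * p)%N ->
  ((64 * d) ^ 2 * (2 ^ c) ^ 2 <= p)%N -> (p <= (128 * d) ^ 2 * (2 ^ c) ^ 2)%N ->
  let y := ncnt t z (2 ^ a) ^+ 2 in
  [\/ exists j J, [/\ (j < a)%N, good t J,
        [&& valid t z, rel t z (2 ^ j.+1) & rel (put J ord0 t) (res J z) (2 ^ j)] &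
        y <= charge_const%:R * rcnt t z J (2 ^ j) ^+ 2],
      exists j J, [/\ (j < c)%N, good t J,
        [&& valid (B := dual B) (dualp t) z, rel (B := dual B) (dualp t) z (2 ^ j.+1) &
            rel (B := dual B) (put J ord0 (dualp t)) (res (B := dual B) J z) (2 ^ j)] &
        y <= charge_const%:R * rcnt (B := dual B) (dualp t) z J (2 ^ j) ^+ 2] |
      exists J, [/\ good t J,
        valid t z && rel (put J ord_max t) (res J z) (2 ^ maxn a c) &
        y <= charge_const%:R *
          (ncnt (put J ord_max t) (res J z) (2 ^ maxn a c) ^+ 2 / p%:R ^+ wgt B J)]].
Proof.
move=> d0 vz t0 rz ap cp pc y.
have vz' : valid (B := dual B) (dualp t) z by rewrite valid_dual.
have t0' : ones (dualp t) != set0 by rewrite ones_dualp.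
set H := (2 ^ a)%N in rz ap y *; set hs := (2 ^ c)%N in cp pc *.
have H0 : (0 < H)%N by rewrite expn_gt0.
have hs0 : (0 < hs)%N by rewrite expn_gt0.
have p0 := prime_gt0 pr_p.
(* [H <= 4 sqrt p] and [hs <= sqrt p / (64 d)]; this places [hs] below the dual scale [K]. *)
have hsK : (8 * (d * H * hs) <= p)%N.
  rewrite -(leq_exp2r _ _ (isT : (0 < 2)%N)).
  apply: leq_trans (_ : (64 * d ^ 2 * hs ^ 2) * (16 * p) <= _)%N.
    have -> : ((8 * (d * H * hs)) ^ 2 = (64 * d ^ 2 * hs ^ 2) * H ^ 2)%N by ring.
    by rewrite leq_mul2l ap orbT.
  have -> : (64 * d ^ 2 * hs ^ 2 * (16 * p) = (1024 * d ^ 2 * hs ^ 2) * p)%N by ring.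
  rewrite expnS expn1 leq_mul2r; apply/orP; right; apply: leq_trans cp.
  have -> : ((64 * d) ^ 2 * hs ^ 2 = 4 * (1024 * d ^ 2 * hs ^ 2))%N by ring.
  by rewrite leq_pmull.
pose K := (p %/ (8 * d * H))%N.
have dH0 : (0 < 8 * d * H)%N by rewrite !muln_gt0 d0 H0.
have hK : (hs <= K)%N.
  by rewrite leq_divRL //; apply: leq_trans hsK; apply/eq_leq; ring.
have K0 : (0 < K)%N by apply: leq_trans hK.
have HKp : (8 * (d * H * K) <= p)%N.
  by apply: leq_trans (leq_trunc_div p (8 * d * H)); apply/eq_leq; rewrite /K; ring.
have pHK : (p <= 16 * d * (H * K))%N.
  have := ltn_ceil p dH0; rewrite -/K => /ltnW/leq_trans; apply.
  apply: leq_trans (_ : (K + K) * (8 * d * H) <= _)%N.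
    by rewrite leq_mul2r -[K.+1]addn1 leq_add2l K0 orbT.
  by apply/eq_leq; ring.
have sd : (2 ^ s <= 2 ^ d)%N by rewrite leq_exp2l // (s_le_d B).
have rest1 : (0 < 16 ^ (2 * d) * ((128 * d) ^ 2) ^ (2 * d))%N.
  by rewrite muln_gt0 !expn_gt0 !muln_gt0 d0.
have sqr_le (u v : rat) : 0 <= u -> 0 <= v -> u <= slope_const%:R * (2 ^+ s * v) ->
    u ^+ 2 <= charge_const%:R * v ^+ 2.
  move=> u0 v0 uv.
  have uv' : u <= (slope_const * 2 ^ d)%:R * v.
    apply: le_trans uv _; rewrite natrM -mulrA ler_wpM2l // ler_wpM2r //.
    by rewrite -natrX ler_nat.
  apply: le_trans (_ : ((slope_const * 2 ^ d)%:R * v) ^+ 2 <= _).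
    by rewrite ler_sqr ?nnegrE ?mulr_ge0.
  rewrite exprMn ler_wpM2r ?sqr_ge0 // -natrX ler_nat /charge_const -mulnA.
  apply: leq_trans (leq_mul (leqnn _) rest1); rewrite muln1.
  by apply: leq_expn2r; rewrite leq_pmulr.
case: (slope_or_dual vz d0 H0 K0 HKp pHK) => slope.
  have [j [J [[ja Jt J0 Pj] le]]] := descend vz t0 rz.
  apply: Or31; exists j, J; split=> //; first by rewrite /good Jt.
  apply: sqr_le; rewrite ?ncnt_ge0 ?rcnt_ge0 //.
  apply: le_trans (slope (2 ^ j)%N _) _; last by rewrite ler_wpM2l.
  apply/andP; split; first by rewrite expn_gt0.
  by rewrite /H leq_exp2l //; exact: ltnW.
have [rz'|nrz'] := boolP (rel (B := dual B) (dualp t) z hs).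
  have [j [J [[jc Jt J0 Pj] le]]] := descend vz' t0' rz'.
  rewrite ones_dualp in Jt.
  apply: Or32; exists j, J; split=> //; first by rewrite /good Jt.
  apply: sqr_le; rewrite ?ncnt_ge0 ?rcnt_ge0 //.
  apply: le_trans (slope (2 ^ j)%N _) _; last by rewrite ler_wpM2l.
  apply/andP; split; first by rewrite expn_gt0.
  by apply: leq_trans hK; rewrite /hs leq_exp2l //; exact: ltnW.
(* The dual is not relevant at [hs], so its typical small vectors vanish on a nonempty [J]. The
   orthogonal of the resulting dual pattern has the blocks of [J] full. *)
have [J [Jt' maj _ J0]] := majority pr_p vz' hs0.
have Jt : J \subset ones t by rewrite -ones_dualp.
have {}J0 := J0 nrz'.
have vput : valid (put J ord_max t) (res J z) by apply: valid_res.
have vput' : valid (B := dual B) (put J ord0 (dualp t)) (res (B := dual B) J z).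
  exact: (valid_res (B := dual B)).
have dualput : dualp (put J ord_max t) = put J ord0 (dualp t).
  by rewrite dualp_put; congr put; apply: val_inj.
(* This scale is at least [2 ^ a], where relevance is known, and at least [2 ^ c], where duality is
   applied. *)
set b := maxn a c.
apply: Or33; exists J; split; first by rewrite /good Jt.
  rewrite vz; apply: rel_le (rel_res vz Jt rz) => //; rewrite /H leq_exp2l //; exact: leq_maxl.
rewrite mulrA ler_pdivlMr ?exprn_gt0 ?ltr0n //.
set G1 := Gam (B := dual B) (put J ord0 (dualp t)) (res (B := dual B) J z) in maj.
set G2 := Gam (put J ord_max t) (res J z).
have G12 : G1 *m G2^T = 0.
  rewrite -[LHS]trmxK trmx_mul trmxK /G1 -dualput.
  by rewrite (Gam_dual vput) trmx0.
have [e0 _] := dlt_put (dual B) Jt'; have [_ e2] := dlt_put B Jt.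
have dd := dltD_dual B t.
have r1 : \rank G1 = dlt B (put J ord0 (dualp t)) by apply: (rank_Gam vput').
have r2 : \rank G2 = dlt B (put J ord_max t) by apply: rank_Gam.
set m := wgt B J in e2 *; have e0' : (dlt B (put J ord0 (dualp t)) + m = dlt B (dualp t))%N := e0.
set u := dlt B (put J ord0 (dualp t)) in r1 e0' *.
set v := dlt B (put J ord_max t) in r2 e2 *.
have [uv1 uv2 uv3 uv4] := dual_exponents e2 e0' dd.
have back : (cnt hs G1 * hs ^ d <= 8 * p ^ u * cnt hs G2)%N.
  rewrite -r1; apply: cnt_duality => //; first by rewrite r1 r2.
  apply: leq_trans cp; rewrite expnMn.
  have -> : (8 * (d * hs * hs) = 8 * d * hs ^ 2)%N by ring.
  apply: leq_mul => //; rewrite -!mulnn; apply: leq_mul => //.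
  by rewrite leq_pmull.
have le : (cnt hs G2 <= cnt (2 ^ b) G2)%N by apply: cnt_le => //; rewrite /hs leq_exp2l // leq_maxr.
set M := (2 ^ b)%N in le *.
have M0 : (0 < M)%N by rewrite expn_gt0.
set w := ncnt (put J ord_max t) (res J z) M.
have w0 : 0 <= w by apply: ncnt_ge0.
have hsr : 0 < (hs%:R : rat) by rewrite ltr0n.
(* The slope bound passes from [H] to the dual count at [hs], [majority] to the dual pattern with
   [J] zero, and [back] to [J] full. The power of [hs] clears the dual normalisation and the
   [hs ^ d] of duality. *)
have key : ncnt t z H * hs%:R ^+ (2 * u + v + m) <=
    (slope_const * 2 ^ d * 8)%:R * p%:R ^+ u * M%:R ^+ v * w.
  rewrite uv2.
  have s1 := slope hs (introT andP (conj hs0 hK)).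
  rewrite exprD mulrA.
  apply: le_trans (_ : slope_const%:R * (2 ^ d * cnt hs G1)%:R * hs%:R ^+ d <= _).
    rewrite ler_wpM2r ?exprn_ge0 //.
    apply: le_trans (ler_wpM2r (exprn_ge0 _ (ltW hsr)) s1) _.
    rewrite -mulrA ler_wpM2l // /ncnt -mulrA mulVf ?mulr1; last first.
      by rewrite expf_neq0 // lt0r_neq0.
    by rewrite ler_nat; apply: leq_trans maj _; rewrite leq_mul2r sd orbT.
  rewrite -[X in _ <= X]mulrA; have -> : M%:R ^+ v * w = (cnt M G2)%:R.
    rewrite /w /ncnt -/G2 -/v mulrCA mulfV ?mulr1 // expf_neq0 // lt0r_neq0 // ltr0n //.
  rewrite -!natrX -!natrM ler_nat.
  apply: leq_trans (_ : slope_const * 2 ^ d * (8 * p ^ u * cnt hs G2) <= _)%N.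
    by rewrite [X in (X * _ <= _)%N]mulnA -[X in (X <= _)%N]mulnA; apply: leq_mul.
  by rewrite !mulnA; apply: leq_mul.
have pq : 0 < (p%:R : rat) by rewrite ltr0n.
have Mp : (M%:R : rat) ^+ 2 <= 16 * p%:R.
  rewrite -natrX -natrM ler_nat /M /b; case: (leqP a c) => ac //.
  apply: leq_trans (_ : p <= _)%N; last by rewrite leq_pmull.
  by apply: leq_trans cp; rewrite leq_pmull // expn_gt0 muln_gt0 d0.
have ph : (p%:R : rat) <= ((128 * d) ^ 2)%:R * hs%:R ^+ 2.
  by rewrite -natrX -natrM ler_nat.
have tb := transfer_back (ncnt_ge0 _ _ _) w0 pq hsr (ler0n _ M) (ler0n _ _)
  (ler0n _ _) key Mp ph.
apply: le_trans tb _.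
rewrite ler_wpM2r ?sqr_ge0 // -!natrX -!natrM ler_nat /charge_const.
apply: leq_mul; first by apply: leq_mul => //; rewrite leq_exp2l.
by apply: leq_pexp2l => //; rewrite expn_gt0 muln_gt0 d0.
Qed.

(** * The induction on the number of ones *)

Definition lg : nat := (trunc_log 2 p).+4.

Lemma scale_lt_lg (a : nat) : ((2 ^ a) ^ 2 <= 16 * p)%N -> (a < lg)%N.
Proof.
move=> ap; have : (2 ^ (a * 2) < 2 ^ (4 + (trunc_log 2 p).+1))%N.
  rewrite expnM; apply: leq_ltn_trans ap _; rewrite expnD ltn_pmul2l //.
  exact: trunc_log_ltn.
by rewrite ltn_exp2l // /lg; lia.
Qed.

(** Sum the charges of [charge] over all labels, scales and sets [J]. The cases with descent are
    bounded by [sum_rcnt], for [B] and for its dual, and the last by [sum_back]; the number of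
    scales costs one factor [lg]. *)
Lemma moment_step (k : nat) (Kb : rat) (B : blocks p d s) t (a : nat) :
  (forall (B : blocks p d s) t a, (#|ones t| <= k)%N ->
     ((2 ^ a) ^ 2 <= 16 * p)%N -> moment B t (2 ^ a) <= Kb) ->
  (0 < d)%N -> ((64 * d) ^ 2 <= p)%N -> (#|ones t| <= k.+1)%N -> ones t != set0 ->
  ((2 ^ a) ^ 2 <= 16 * p)%N ->
  moment B t (2 ^ a) <= (charge_const * 5 * 14 ^ d * 2 ^ d)%:R * lg%:R * Kb.
Proof.
move=> IH d0 dp tk t0 ap.
have D0 : (0 < (64 * d) ^ 2)%N by rewrite expn_gt0 muln_gt0 d0.
(* The largest [c] with [(64 d)^2 * 4^c <= p]; one more factor 4 turns [64 d] into [128 d] in the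
   reverse bound. *)
pose c := trunc_log 4 (p %/ (64 * d) ^ 2).
have q0 : (0 < p %/ (64 * d) ^ 2)%N by rewrite divn_gt0.
have c4 : ((2 ^ c) ^ 2 = 4 ^ c)%N by rewrite -expnM mulnC expnM.
have cp : ((64 * d) ^ 2 * (2 ^ c) ^ 2 <= p)%N.
  rewrite c4 mulnC; apply: leq_trans (leq_trunc_div p ((64 * d) ^ 2)).
  by rewrite leq_mul2r trunc_logP ?orbT.
have pc : (p <= (128 * d) ^ 2 * (2 ^ c) ^ 2)%N.
  have -> : ((128 * d) ^ 2 * (2 ^ c) ^ 2 = (4 * 4 ^ c) * (64 * d) ^ 2)%N by rewrite c4; ring.
  apply: leq_trans (ltnW (ltn_ceil p D0)) _; rewrite leq_mul2r -expnS.
  by rewrite trunc_log_ltn ?orbT.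
have c16 : ((2 ^ c) ^ 2 <= 16 * p)%N.
  apply: leq_trans (_ : p <= _)%N; last by rewrite leq_pmull.
  by apply: leq_trans cp; rewrite leq_pmull.
(* Apply the hypothesis to the zero pattern, whose moment is a sum of squares. *)
have Kb0 : 0 <= Kb.
  have t0k : (#|ones [ffun _ : 'I_s => ord0 : 'I_3]| <= k)%N.
    by rewrite (_ : ones _ = set0) ?cards0 //; apply/setP=> i; rewrite !inE ffunE.
  by apply: le_trans (IH B _ a t0k ap); apply: sumr_ge0 => z _; apply: sqr_ge0.
have l0 : 0 < lg%:R :> rat by rewrite ltr0n.
pose lab := {ffun 'I_s -> bs_L B}.
pose P1 (B' : blocks p d s) t' j J (z : {ffun 'I_s -> bs_L B'}) :=
  [&& valid t' z, rel t' z (2 ^ j.+1) & rel (put J ord0 t') (res J z) (2 ^ j)].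
pose P3 J (z : lab) := valid t z && rel (put J ord_max t) (res J z) (2 ^ maxn a c).
(* The three kinds of charges, extended by zero so that each sum runs over all labels, scales and
   sets [J] and can be exchanged. *)
pose f1 (z : lab) (j : 'I_lg) J : rat :=
  if good t J && ((2 ^ j) ^ 2 <= 16 * p)%N && P1 B t j J z then rcnt t z J (2 ^ j) ^+ 2 else 0.
pose f2 (z : lab) (j : 'I_lg) J : rat :=
  if good t J && ((2 ^ j) ^ 2 <= 16 * p)%N && P1 (dual B) (dualp t) j J z
  then rcnt (B := dual B) (dualp t) z J (2 ^ j) ^+ 2 else 0.
pose f3 (z : lab) J : rat :=
  if good t J && P3 J z
  then ncnt (put J ord_max t) (res J z) (2 ^ maxn a c) ^+ 2 / p%:R ^+ wgt B J else 0.
have f10 z j J : 0 <= f1 z j J by rewrite /f1; case: ifP => _ //; apply: sqr_ge0.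
have f20 z j J : 0 <= f2 z j J by rewrite /f2; case: ifP => _ //; apply: sqr_ge0.
have f30 z J : 0 <= f3 z J.
  by rewrite /f3; case: ifP => _ //; rewrite divr_ge0 ?sqr_ge0 ?exprn_ge0.
have lt_scale j b : (j < b)%N -> ((2 ^ b) ^ 2 <= 16 * p)%N ->
    (j < lg)%N /\ ((2 ^ j) ^ 2 <= 16 * p)%N.
  move=> jb bp; have jp : ((2 ^ j) ^ 2 <= 16 * p)%N.
    by apply: leq_trans bp; apply: leq_expn2r; rewrite leq_exp2l // ltnW.
  by split=> //; apply: scale_lt_lg.
have point z : valid t z && rel t z (2 ^ a) -> ncnt t z (2 ^ a) ^+ 2 <=
    charge_const%:R * (\sum_j \sum_J f1 z j J + \sum_j \sum_J f2 z j J + \sum_J f3 z J).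
  case/andP=> vz rz.
  have S1 : 0 <= \sum_j \sum_J f1 z j J by apply: sumr_ge0 => j _; apply: sumr_ge0.
  have S2 : 0 <= \sum_j \sum_J f2 z j J by apply: sumr_ge0 => j _; apply: sumr_ge0.
  have S3 : 0 <= \sum_J f3 z J by apply: sumr_ge0.
  case: (charge d0 vz t0 rz ap cp pc) => [[j [J [ja gJ Pj /le_trans]]]|
      [j [J [jc gJ Pj /le_trans]]]|[J [gJ PJ /le_trans]]]; apply; rewrite ler_wpM2l //.
  - have [jl jp] := lt_scale _ _ ja ap.
    apply: le_trans (_ : f1 z (Ordinal jl) J <= _).
      by rewrite /f1 gJ jp /P1 Pj.
    apply: le_trans (_ : \sum_J f1 z (Ordinal jl) J <= _); first exact: ler_sum_term.
    apply: le_trans (_ : \sum_j \sum_J f1 z j J <= _).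
      by apply: (@ler_sum_term _ _ predT (fun j => \sum_J f1 z j J)) => // i; apply: sumr_ge0.
    lra.
  - have [jl jp] := lt_scale _ _ jc c16.
    apply: le_trans (_ : f2 z (Ordinal jl) J <= _).
      by rewrite /f2 gJ jp /P1 Pj.
    apply: le_trans (_ : \sum_J f2 z (Ordinal jl) J <= _); first exact: ler_sum_term.
    apply: le_trans (_ : \sum_j \sum_J f2 z j J <= _).
      by apply: (@ler_sum_term _ _ predT (fun j => \sum_J f2 z j J)) => // i; apply: sumr_ge0.
    lra.
  apply: le_trans (_ : f3 z J <= _); first by rewrite /f3 gJ /P3 PJ.
  apply: le_trans (_ : \sum_J f3 z J <= _); first exact: ler_sum_term.
  lra.
have bd1 j J : \sum_z f1 z j J <= 2 * 7 ^+ d * Kb.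
  rewrite /f1 -big_mkcond /=; have [/andP[gJ jp]|_] := boolP (_ && _); last first.
    by rewrite big_pred0 // !mulr_ge0 ?exprn_ge0.
  exact: (sum_rcnt IH B tk gJ jp).
have bd2 j J : \sum_z f2 z j J <= 2 * 7 ^+ d * Kb.
  rewrite /f2 -big_mkcond /=; have [/andP[gJ jp]|_] := boolP (_ && _); last first.
    by rewrite big_pred0 // !mulr_ge0 ?exprn_ge0.
  have tk' : (#|ones (dualp t)| <= k.+1)%N by rewrite ones_dualp.
  have gJ' : good (dualp t) J by rewrite /good ones_dualp.
  exact: (sum_rcnt IH (dual B) tk' gJ' jp).
have m16 : ((2 ^ maxn a c) ^ 2 <= 16 * p)%N by case: (leqP a c).
have bd3 J : \sum_z f3 z J <= 2 ^+ s * Kb.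
  rewrite /f3 -big_mkcond /=; have [gJ|_] := boolP (good t J); last first.
    by rewrite big_pred0 // mulr_ge0 ?exprn_ge0.
  exact: (sum_back IH B tk gJ m16).
rewrite /moment; apply: le_trans (ler_sum _ point) _.
rewrite -mulr_sumr.
apply: le_trans (_ : charge_const%:R * (2 ^+ s * lg%:R * (2 * 7 ^+ d * Kb) +
  2 ^+ s * lg%:R * (2 * 7 ^+ d * Kb) + 2 ^+ s * (2 ^+ s * Kb)) <= _).
  rewrite ler_wpM2l //.
  have cs : #|{: {set 'I_s}}| = (2 ^ s)%N.
    by rewrite -cardsT -powersetT card_powerset cardsT card_ord.
  apply: le_trans (_ : \sum_z (\sum_j \sum_J f1 z j J + \sum_j \sum_J f2 z j J +
      \sum_J f3 z J) <= _).
    rewrite [leLHS]big_mkcond; apply: ler_sum => z _; case: ifP => // _.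
    by rewrite !addr_ge0 // ?sumr_ge0 // => j _; rewrite sumr_ge0.
  have sumbound (f : lab -> 'I_lg -> {set 'I_s} -> rat) X :
      (forall j J, \sum_z f z j J <= X) ->
      \sum_z \sum_j \sum_J f z j J <= 2 ^+ s * lg%:R * X.
    move=> fX; rewrite exchange_big /=.
    apply: le_trans (_ : \sum_(j < lg) \sum_(J : {set 'I_s}) X <= _).
      by apply: ler_sum => j _; rewrite exchange_big; apply: ler_sum => J _.
    rewrite !sumr_const cs card_ord -mulrnA -[_ *+ _]mulr_natl natrM natrX; exact: lexx.
  rewrite !big_split /= !lerD ?sumbound //.
  rewrite exchange_big /=.
  apply: le_trans (_ : \sum_(J : {set 'I_s}) 2 ^+ s * Kb <= _); first exact: ler_sum.
  by rewrite sumr_const cs -[_ *+ _]mulr_natl natrX.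
have := step_arith (ler0n _ charge_const) Kb0 (_ : 1 <= lg%:R) (s_le_d B).
by rewrite !natrM !natrX; apply; rewrite ler1n.
Qed.

End Moments.

(** The bound is uniform in the block system because the induction step passes to the dual. The
    constant [C2] covers [p < (64 d)^2], where the trivial bound is enough. *)
Lemma moment_bound (d k : nat) : (0 < d)%N -> exists C e : nat,
  forall (p s : nat) (B : blocks p d s) t a, prime p -> (#|ones t| <= k)%N ->
    ((2 ^ a) ^ 2 <= 16 * p)%N -> moment B t (2 ^ a) <= C%:R * (lg p)%:R ^+ e.
Proof.
move=> d0; elim: k => [|k [C [e IH]]].
  exists (8 ^ d)%N, 0%N => p s B t a pr_p; rewrite leqn0 cards_eq0 => /eqP t0 _.
  have h0 : (0 < 2 ^ a)%N by rewrite expn_gt0.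
  by have := moment_le_trivial pr_p B t h0; rewrite t0 /wgt big_set0 !expr0 !mulr1 natrX.
pose C1 := (charge_const d * 5 * 14 ^ d * 2 ^ d)%N.
pose C2 := (8 ^ d * ((64 * d) ^ 2) ^ d)%N.
exists (C + C1 * C + C2)%N, e.+1 => p s B t a pr_p tk ap.
have l1 : (1 : rat) <= (lg p)%:R by rewrite ler1n.
have le1 : (1 : rat) <= (lg p)%:R ^+ e by rewrite exprn_ege1.
have le2 : (1 : rat) <= (lg p)%:R ^+ e.+1 by rewrite exprn_ege1.
have le3 : (lg p)%:R ^+ e <= (lg p)%:R ^+ e.+1 :> rat by rewrite ler_weXn2l.
have h0 : (0 < 2 ^ a)%N by rewrite expn_gt0.
rewrite !natrD !mulrDl.
have c0 : 0 <= C%:R * (lg p)%:R ^+ e.+1 :> rat by rewrite mulr_ge0 // ltW // (lt_le_trans ltr01).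
have c1 : 0 <= (C1 * C)%:R * (lg p)%:R ^+ e.+1 :> rat by rewrite mulr_ge0 // ltW // (lt_le_trans ltr01).
have c2 : 0 <= C2%:R * (lg p)%:R ^+ e.+1 :> rat by rewrite mulr_ge0 // ltW // (lt_le_trans ltr01).
have [t0|t0] := eqVneq (ones t) set0.
  have tk0 : (#|ones t| <= k)%N by rewrite t0 cards0.
  apply: le_trans (IH p s B t a pr_p tk0 ap) _.
  apply: le_trans (_ : C%:R * (lg p)%:R ^+ e.+1 <= _); first by rewrite ler_wpM2l.
  by rewrite -addrA lerDl addr_ge0.
have [dp|dp] := leqP ((64 * d) ^ 2) p.
  have IH' B' t' a' := IH p s B' t' a' pr_p.
  apply: le_trans (moment_step pr_p B IH' d0 dp tk t0 ap) _.
  apply: le_trans (_ : (C1 * C)%:R * (lg p)%:R ^+ e.+1 <= _); last first.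
    by rewrite -addrA addrCA lerDl addr_ge0.
  by apply: ler_eq; rewrite -/C1 natrM exprS; ring.
apply: le_trans (moment_le_trivial pr_p B t h0) _.
apply: le_trans (_ : C2%:R * (lg p)%:R ^+ e.+1 <= _); last by rewrite lerDr addr_ge0.
apply: le_trans (_ : C2%:R <= _); last by rewrite -[leLHS]mulr1 ler_wpM2l.
rewrite /C2 natrM natrX ler_wpM2l ?exprn_ge0 // -natrX ler_nat.
apply: leq_trans (leq_expn2r _ (ltnW dp)) _; apply: leq_pexp2l; last exact: wgt_le.
by rewrite expn_gt0 muln_gt0 d0.
Qed.

(** * Pairs of points on a common member of the spread *)

Definition allones (s : nat) : {ffun 'I_s -> 'I_3} := [ffun _ => inord 1].

Lemma ones_allones (s : nat) : ones (allones s) = setT.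
Proof. by apply/setP=> i; rewrite !inE ffunE inordK. Qed.

Section Pairs.
Variables (p : nat) (pr_p : prime p) (d s : nat) (B : blocks p d s).
Local Notation F := 'F_p.
Local Notation lab := {ffun 'I_s -> bs_L B}.
Local Notation t1 := (allones s).

Definition aligned (x y : 'rV[F]_d) (z : lab) : bool :=
  [&& valid t1 z, (x <= Gam t1 z)%MS & (y <= Gam t1 z)%MS].

(** Classify a pair by the set [J] of blocks where [x - y] vanishes and by its label reset on [J].
    Then [x - y] witnesses the relevance of the pattern with [J] zero, while [x] ranges over a
    translate of small vectors for [J] full. The product of the two counts is [M ^ d] times
    normalised counts, since the two dimensions add up to [d]. *)
Lemma card_aligned (X : {set 'rV[F]_d}) (m : nat) (Kb : rat) :
  (forall x y, x \in X -> y \in X -> smallv (2 ^ m) (x - y)) ->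
  (forall t, moment B t (2 ^ m) <= Kb) ->
  (#|[set xy in setX X X | [exists z, aligned xy.1 xy.2 z]]|%:R : rat) <=
    2 ^+ s.+1 * Kb * (2 ^ m)%:R ^+ d.
Proof.
move=> close mom; set M := (2 ^ m)%N; set E := [set xy in _ | _].
pose zof (xy : 'rV[F]_d * 'rV[F]_d) : lab :=
  odflt [ffun _ => bs_z0 B] [pick z | aligned xy.1 xy.2 z].
pose Jof (xy : 'rV[F]_d * 'rV[F]_d) : {set 'I_s} := [set i | (xy.1 - xy.2) *m bs_e B i == 0].
pose key xy := (Jof xy, res (Jof xy) (zof xy)).
pose a J (z : lab) := cnt M (Gam (put J ord0 t1) z).
pose b J (z : lab) := cnt M (Gam (put J ord_max t1) z).
pose P J (z : lab) := valid (put J ord0 t1) z && rel (put J ord0 t1) z M.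
have EP xy : xy \in E -> [/\ xy.1 \in X, xy.2 \in X & aligned xy.1 xy.2 (zof xy)].
  case: xy => x y; rewrite inE in_setX => /andP[/andP[x1 x2] /existsP[z zP]]; split=> //.
  by rewrite /zof; case: pickP => // /(_ z); rewrite zP.
have sub2 xy : xy \in E ->
    (xy.1 <= Gam (put (Jof xy) ord_max t1) (key xy).2)%MS.
  case/EP=> x1 x2 /and3P[vz g1 g2].
  apply/(sub_GamP _ (valid_res _ _ vz)) => // i.
  have [iJ|iJ] := boolP (i \in Jof xy); first by rewrite /blk ffunE iJ submxMl.
  by rewrite blk_put_out //; apply: (sub_GamP _ vz g1).
have sub0 xy : xy \in E ->
    (xy.1 - xy.2 <= Gam (put (Jof xy) ord0 t1) (key xy).2)%MS.
  case/EP=> x1 x2 /and3P[vz g1 g2].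
  apply/(sub_GamP _ (valid_res _ _ vz)) => // i.
  have [iJ|iJ] := boolP (i \in Jof xy).
    by move: iJ; rewrite inE => /eqP ->; rewrite sub0mx.
  rewrite blk_put_out // mulmxBl addmx_sub ?eqmx_opp //; first exact: (sub_GamP _ vz g1).
  exact: (sub_GamP _ vz g2).
have keyP xy : xy \in E -> P (Jof xy) (key xy).2.
  move=> xyE; have [x1 x2 /and3P[vz _ _]] := EP _ xyE.
  rewrite /P valid_res //=; apply/existsP; exists (xy.1 - xy.2).
  apply/and3P; split; [exact: sub0 | exact: close |].
  by apply/forall_inP=> i; rewrite ones_put // inE ones_allones !inE andbT.
have fib (k : {set 'I_s} * lab) : (#|[set xy in E | key xy == k]| <= a k.1 k.2 * b k.1 k.2)%N.
  pose Y : {set 'rV[F]_d} := [set x in X | (x <= Gam (put k.1 ord_max t1) k.2)%MS].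
  apply: leq_trans (_ : a k.1 k.2 * #|Y| <= _)%N; last first.
    rewrite leq_mul2l; apply/orP; right; apply: card_close_le_cnt => x y.
    rewrite !inE => /andP[xX xG] /andP[yX yG].
    by rewrite addmx_sub ?eqmx_opp //= close.
  rewrite /a /cnt -cardsX -(card_in_imset (f := fun xy => (xy.1 - xy.2, xy.1))).
    apply/subset_leq_card/subsetP=> g /imsetP[xy]; rewrite inE => /andP[xyE /eqP kE] ->.
    have [x1 x2 _] := EP _ xyE.
    apply/setXP; split; rewrite inE -kE; first by rewrite (sub0 xy xyE) close.
    by rewrite x1 (sub2 xy xyE).
  move=> [x y] [x' y'] _ _ eq; have xx' : x = x' := congr1 snd eq.
  have e : x - y = x' - y' := congr1 fst eq.
  by rewrite -xx' in e *; congr (_, _); apply: oppr_inj; apply: addrI e.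
have cE : (#|E|%:R : rat) <= \sum_(J : {set 'I_s}) \sum_(z : lab | P J z) (a J z)%:R * (b J z)%:R.
  rewrite pair_big_dep /= -sum1_card natr_sum.
  rewrite (partition_big key (fun k => P k.1 k.2)) /=; last exact: keyP.
  apply: ler_sum => k _; rewrite -natrM -natr_sum ler_nat; apply: leq_trans (fib k).
  by rewrite -sum1_card; apply/eq_leq/eq_bigl=> xy; rewrite inE.
apply: le_trans cE _.
apply: le_trans (_ : \sum_(J : {set 'I_s}) 2 * Kb * M%:R ^+ d <= _); last first.
  rewrite sumr_const -[_ *+ _]mulr_natl.
  rewrite -cardsT -powersetT card_powerset cardsT card_ord natrX exprS.
  by apply: ler_eq; ring.
apply: ler_sum => J _.
have Mr : 0 < (M%:R : rat) by rewrite ltr0n expn_gt0.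
have Jt : J \subset ones t1 by rewrite ones_allones subsetT.
have [e0 e2] := dlt_put B Jt.
(* The pattern of all ones is its own dual. *)
have d1 : (dlt B t1 + dlt B t1 = d)%N.
  rewrite -[RHS](dltD_dual B t1); congr (_ + dlt B _)%N; apply/ffunP=> i.
  by rewrite !ffunE; apply: val_inj; rewrite /= inordK.
have dsum : (dlt B (put J ord0 t1) + dlt B (put J ord_max t1) = d)%N by rewrite e2 addnCA e0 d1.
apply: le_trans (_ : (\sum_(z : lab | P J z) (ncnt (put J ord0 t1) z M ^+ 2 +
   ncnt (put J ord_max t1) z M ^+ 2)) * M%:R ^+ d <= _).
  rewrite mulr_suml; apply: ler_sum => z _.
  pose x := ncnt (put J ord0 t1) z M; pose y := ncnt (put J ord_max t1) z M.
  have -> : (a J z)%:R * (b J z)%:R = x * y * M%:R ^+ d.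
    rewrite -dsum exprD /x /y /ncnt -/(a J z) -/(b J z).
    have h1 : (M%:R : rat) ^+ dlt B (put J ord0 t1) != 0 by rewrite expf_neq0 // lt0r_neq0.
    have h2 : (M%:R : rat) ^+ dlt B (put J ord_max t1) != 0 by rewrite expf_neq0 // lt0r_neq0.
    by rewrite [RHS]mulrACA !divfK.
  rewrite ler_pM2r ?exprn_gt0 // -/x -/y.
  have : 0 <= (x - y) ^+ 2 by apply: sqr_ge0.
  have : 0 <= x * y by apply: mulr_ge0; apply: ncnt_ge0.
  by rewrite sqrrB; lra.
rewrite ler_wpM2r ?exprn_ge0 ?(ltW Mr) // big_split /=.
have -> : 2 * Kb = Kb + Kb by ring.
apply: lerD; first exact: (mom (put J ord0 t1)).
apply: le_trans (mom (put J ord_max t1)); rewrite /moment [leRHS]big_mkcond [leLHS]big_mkcond.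
apply: ler_sum => z _; rewrite /P (valid_put _ _ _ (c := ord0) (c' := ord_max)) //.
case: ifP => [/andP[vz rz]|_]; last by case: ifP => _; rewrite ?sqr_ge0.
by rewrite vz rel_put_max // (valid_put _ _ _ (c' := ord_max)).
Qed.
End Pairs.

(** * The block system of lines over extension fields *)

Section Lines.
Variables (p : nat) (pr_p : prime p) (n s : nat) (ns : 'I_s -> nat).
Variables (K : 'I_s -> finFieldType) (Q : 'I_s -> 'M['F_p]_n).
Variables (lm : forall i, 'rV['F_p]_n -> K i) (sec : forall i, K i -> 'rV['F_p]_n).
Arguments sec : clear implicits.
Arguments lm : clear implicits.
Hypothesis ns_gt0 : forall i, (0 < ns i)%N.
Hypothesis sum_ns : (\sum_i ns i = n)%N.
Hypothesis card_K : forall i, #|K i| = (p ^ ns i)%N.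
Hypothesis Q_idem : forall i j, Q i *m Q j = if i == j then Q i else 0.
Hypothesis Q_sum : \sum_i Q i = 1%:M.
Hypothesis sec_Q : forall i y, sec i y *m Q i = sec i y.
Hypothesis lm_sec : forall i y, lm i (sec i y) = y.
Hypothesis sec_lm : forall i v, sec i (lm i v) = v *m Q i.
Hypothesis sec_add : forall i, {morph sec i : x y / x + y}.
Local Notation F := 'F_p.
Local Notation d := (n + n)%N.

(* [None] is the point at infinity of the projective line over [K i]. *)
Definition line_pt i (z : option (K i)) (y : K i) : 'rV[F]_d :=
  if z is Some c then row_mx (sec i (c * y)) (sec i y) else row_mx (sec i y) (sec i 0).

Definition line_set i (z : option (K i)) : {set 'rV[F]_d} := line_pt z @: setT.

(** Additive subgroups of a vector space over the prime field are subspaces; [rowg_mx] gives a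
    matrix with this row space. *)
Definition line_mx i (z : option (K i)) : 'M[F]_d := rowg_mx (line_set z).

Definition dblock i : 'M[F]_d := block_mx (Q i) 0 0 (Q i).

Lemma sec_inj i : injective (sec i).
Proof. exact: can_inj (lm_sec (i := i)). Qed.

Lemma sec0 i : sec i 0 = 0.
Proof. by apply: (addrI (sec i 0)); rewrite -sec_add !addr0. Qed.

Lemma line_pt_inj i z : injective (@line_pt i z).
Proof. by case: z => [c|] x y /eq_row_mx[e1 e2]; apply: sec_inj. Qed.

Lemma line_group_set i z : group_set (@line_set i z).
Proof.
apply/group_setP; split.
  apply/imsetP; exists 0; rewrite ?inE //.
  by case: z => [c|] /=; rewrite ?mulr0 !sec0 row_mx0.
move=> u v /imsetP[x _ ->] /imsetP[y _ ->]; apply/imsetP; exists (x + y); rewrite ?inE //.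
change (line_pt z x + line_pt z y = line_pt z (x + y)).
by case: z => [c|] /=; rewrite add_row_mx ?mulrDr !sec_add // sec0 addr0.
Qed.

Lemma sub_line_mx i (z : option (K i)) (v : 'rV[F]_d) : (v <= line_mx z)%MS = (v \in line_set z).
Proof.
by have /setP/(_ v) := rowg_mxK (Group (line_group_set z)); rewrite mem_rowg.
Qed.

Lemma rank_line_mx i (z : option (K i)) : \rank (line_mx z) = ns i.
Proof.
rewrite /line_mx -[line_set z]/(gval (Group (line_group_set z))) mxrank_rowg //.
by rewrite /= card_imset ?cardsT ?card_K ?pfactorK //; apply: line_pt_inj.
Qed.

(** The row space of [Q i] is the image of [sec i], which has [p ^ ns i] elements. *)
Lemma rank_Q i : \rank (Q i) = ns i.
Proof.
have := card_rowg (Q i); rewrite card_Fp // => /esym.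
have -> : rowg (Q i) = sec i @: setT.
  apply/setP=> v; rewrite inE; apply/idP/imsetP => [/submxP[D vE]|[y _ ->]]; last first.
    by rewrite -sec_Q submxMl.
  exists (lm i v); rewrite ?inE // sec_lm vE -mulmxA Q_idem eqxx //.
rewrite card_imset ?cardsT ?card_K; last exact: sec_inj.
by move/eqP; rewrite eqn_exp2l ?prime_gt1 // => /eqP.
Qed.

Lemma mul_dblock i (a b : 'rV[F]_n) : row_mx a b *m dblock i = row_mx (a *m Q i) (b *m Q i).
Proof. by rewrite mul_row_block !mulmx0 addr0 add0r. Qed.

Lemma mul_dblock_line i (z : option (K i)) v : v \in line_set z -> v *m dblock i = v.
Proof.
by case/imsetP=> y _ ->; case: z => [c|] /=; rewrite mul_dblock !sec_Q.
Qed.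

Lemma line_spread i (z z' : option (K i)) (v : 'rV[F]_d) :
  v \in line_set z -> v \in line_set z' -> v != 0 -> z = z'.
Proof.
case/imsetP=> y _ -> /imsetP[y' _].
case: z z' => [c|] [c'|] //= /eq_row_mx[e1 e2] nz.
- have yy := sec_inj e2; rewrite -yy in e1; congr Some; move/sec_inj: e1.
  have [y0|y0] := eqVneq y 0; last exact: mulIf.
  by rewrite y0 mulr0 sec0 row_mx0 eqxx in nz.
- by move/sec_inj: e2 => y0; rewrite y0 mulr0 sec0 row_mx0 eqxx in nz.
- move/sec_inj: e2 => y0; rewrite -y0 mulr0 in e1.
  by rewrite e1 sec0 row_mx0 eqxx in nz.
Qed.

(** The subspaces themselves serve as labels, because [bs_L] is one type for all [i] while the
    fields [K i] vary. *)
Definition line_labels i : {set 'M[F]_d} := @line_mx i @: setT.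

Lemma dblock_dim : d = (\sum_i 2 * ns i)%N.
Proof. by rewrite -big_distrr /= sum_ns mul2n addnn. Qed.

Lemma dblock_idem i j : dblock i *m dblock j = if i == j then dblock i else 0.
Proof.
rewrite mulmx_block !mulmx0 !mul0mx !addr0 !add0r Q_idem.
by case: ifP => // _; rewrite block_mx0.
Qed.

Lemma dblock_sum : \sum_i dblock i = 1%:M.
Proof.
rewrite scalar_mx_block -Q_sum.
have -> : \sum_i dblock i = block_mx (\sum_i Q i) 0 0 (\sum_i Q i).
  elim/big_rec2: _ => [|i x y _ ->]; first by rewrite block_mx0.
  by rewrite /dblock add_block_mx !addr0.
by [].
Qed.

Lemma dblock_rank i : \rank (dblock i) = (2 * ns i)%N.
Proof. by rewrite rank_diag_block_mx rank_Q addnn mul2n. Qed.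

Lemma labels_sub i A : A \in line_labels i -> (A <= dblock i)%MS.
Proof.
case/imsetP=> z _ ->; apply/rV_subP=> v; rewrite sub_line_mx => /mul_dblock_line <-.
exact: submxMl.
Qed.

Lemma labels_rank i A : A \in line_labels i -> \rank A = ns i.
Proof. by case/imsetP=> z _ ->; apply: rank_line_mx. Qed.

Lemma labels_spread i (A A' : 'M[F]_d) (v : 'rV[F]_d) : A \in line_labels i ->
  A' \in line_labels i -> A != A' -> (v <= A)%MS -> (v <= A')%MS -> v = 0.
Proof.
case/imsetP=> z _ -> /imsetP[z' _ ->] ne; rewrite !sub_line_mx => vz vz'.
by apply/eqP; apply: contraNT ne => v0; rewrite (line_spread vz vz' v0).
Qed.

Lemma labels_card i : (#|line_labels i| <= 2 * p ^ ns i)%N.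
Proof.
apply: leq_trans (leq_imset_card _ _) _; rewrite cardsT card_option card_K.
by have : (0 < p ^ ns i)%N by [rewrite expn_gt0 prime_gt0]; lia.
Qed.

Definition line_blocks : blocks p d s :=
  @Blocks p d s ns _ (0 : 'M[F]_d) dblock line_labels (fun _ A => A) ns_gt0 dblock_dim
    dblock_idem dblock_sum dblock_rank labels_sub labels_rank labels_spread labels_card.

(** The relation says that the two points with coordinates [lm i x, lm i x'] and [lm i y, lm i y']
    of the plane over [K i] lie on a common line through the origin. *)
Lemma lines_aligned (x x' y y' : 'rV[F]_n) :
  (forall i, lm i x * lm i y' = lm i x' * lm i y) ->
  [exists z, aligned (B := line_blocks) (row_mx x x') (row_mx y y') z].
Proof.
move=> xy.
have ex i : {z : option (K i) | row_mx x x' *m dblock i \in line_set z /\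
    row_mx y y' *m dblock i \in line_set z}.
  rewrite !mul_dblock -!sec_lm.
  (* The slope is that of the first point if [lm i x'] is nonzero. Otherwise the line is at infinity
     if also [lm i y' = 0], and else the first point is the origin and the slope is that of the
     second. *)
  have [x0|x0] := eqVneq (lm i x') 0; last first.
    exists (Some (lm i x / lm i x')); split; apply/imsetP.
      by exists (lm i x') => //=; rewrite divfK.
    exists (lm i y') => //=; congr (row_mx (sec i _) _).
    by rewrite mulrAC xy mulrAC mulfV // mul1r.
  have [y0|y0] := eqVneq (lm i y') 0.
    exists None; split; apply/imsetP; [exists (lm i x) | exists (lm i y)] => //=;
      by rewrite ?x0 ?y0.
  have xz : lm i x = 0.
    by have /eqP := xy i; rewrite x0 mul0r mulf_eq0 (negPf y0) orbF => /eqP.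
  exists (Some (lm i y / lm i y')); split; apply/imsetP.
    by exists 0 => //=; rewrite x0 xz mulr0.
  by exists (lm i y') => //=; rewrite divfK.
apply/existsP; exists [ffun i => line_mx (sval (ex i))].
set z : {ffun 'I_s -> 'M[F]_d} := finfun _.
have vz : valid (B := line_blocks) (allones s) z.
  apply/forallP=> i; rewrite ones_allones inE /= ffunE.
  by apply/imsetP; exists (sval (ex i)).
have blkE i : blk (B := line_blocks) (allones s) z i = line_mx (sval (ex i)).
  by rewrite /blk ffunE inordK //= ffunE.
apply/and3P; split=> //; apply/sub_GamP=> // i; rewrite blkE sub_line_mx /=.
  by case: (svalP (ex i)).
by case: (svalP (ex i)).
Qed.

End Lines.

(** * Coordinates given by the linear forms *)

Section Coordinates.
Variables (p : nat) (pr_p : prime p) (n s : nat) (ns : 'I_s -> nat).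
Variables (K : 'I_s -> finFieldType) (w : forall i, K i).
Variable (L : forall i : 'I_s, 'I_(ns i) -> 'I_n -> 'F_p).
Hypothesis ns_gt0 : forall i, (0 < ns i)%N.
Hypothesis sum_ns : (\sum_(i < s) ns i)%N = n.
Hypothesis char_K : forall i, p \in [pchar (K i)].
Hypothesis basis_w : forall i, @power_basis p (K i) (ns i) (w i).
Hypothesis indep_L : forms_lin_indep L.
Local Notation F := 'F_p.

Let index : finType := {i : 'I_s & 'I_(ns i)}.

Lemma card_index : #|index| = n.
Proof.
rewrite -sum_ns card_tagged sumnE big_map big_enum /=.
by apply: eq_bigr => i _; rewrite card_ord.
Qed.

Definition idx (c : 'I_n) : index := enum_val (cast_ord (esym card_index) c).
Definition pos (q : index) : 'I_n := cast_ord card_index (enum_rank q).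

Lemma idxK : cancel idx pos.
Proof. by move=> c; rewrite /pos /idx enum_valK cast_ordKV. Qed.

Lemma posK : cancel pos idx.
Proof. by move=> q; rewrite /pos /idx cast_ordK enum_rankK. Qed.

Definition formmx : 'M[F]_n := \matrix_(k, c) L (tagged (idx c)) k.

Lemma formmx_unit : formmx \in unitmx.
Proof.
rewrite -unitmx_tr -row_free_unit -kermx_eq0; apply/rowV0P=> v /sub_kermxP vL.
pose c i (j : 'I_(ns i)) := v 0 (pos (Tagged (fun i => 'I_(ns i)) j)).
have c0 : forall i j, c i j = 0.
  apply: indep_L => k; rewrite (sig_big_dep (fun _ => true) (fun _ _ => true)
     (fun i (j : 'I_(ns i)) => c i j * L j k)) /=.
  have /rowP/(_ k) := vL; rewrite !mxE (reindex pos) /=; last first.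
    by exists idx => q _; rewrite ?posK ?idxK.
  move=> e0; rewrite -[RHS]e0; apply: eq_bigr => -[i j] _; rewrite !mxE.
  by rewrite posK.
apply/rowP=> a; rewrite mxE -(idxK a); case: (idx a) => i j; exact: (c0 i j).
Qed.

Definition emb i (x : F) : K i := (x : nat)%:R.

Lemma natr_modp i (a : nat) : (a %% p)%:R = a%:R :> K i.
Proof.
by rewrite [in RHS](divn_eq a p) natrD natrM (pcharf0 (char_K i)) mulr0 add0r.
Qed.

Lemma emb_natr i (a : nat) : emb i a%:R = a%:R.
Proof. by rewrite /emb val_Fp_nat // natr_modp. Qed.

Lemma emb_add i : {morph emb i : x y / x + y}.
Proof. by move=> x y; rewrite -{1}(natr_Zp x) -{1}(natr_Zp y) -natrD emb_natr natrD. Qed.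

Definition lmap i (v : 'rV[F]_n) : K i :=
  \sum_(j < ns i) emb i ((v *m formmx) 0 (pos (Tagged (fun i => 'I_(ns i)) j))) * w i ^+ j.

Lemma lmap_add i : {morph lmap i : u v / u + v}.
Proof.
move=> u v; rewrite -big_split; apply: eq_bigr => j _ /=.
by rewrite mulmxDl [X in emb i X]mxE emb_add mulrDl.
Qed.

Lemma lam_lmap i (x : 'I_n -> int) : lam w L i x = lmap i (\row_k (x k)%:~R).
Proof.
apply: eq_bigr => j _; congr (_ * _); rewrite /emb /eval_form; congr (_%:R); congr nat_of_ord.
by rewrite mxE; apply: eq_bigr => k _; rewrite !mxE posK mulrC.
Qed.

Definition selmx i : 'M[F]_n := diag_mx (\row_c (tag (idx c) == i)%:R).
(** In the coordinates given by the forms, it keeps those of the [i]-th group and kills the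
    others. *)
Definition projmx i : 'M[F]_n := formmx *m selmx i *m invmx formmx.

Lemma projmx_idem i j : projmx i *m projmx j = if i == j then projmx i else 0.
Proof.
rewrite /projmx -!mulmxA (mulKmx formmx_unit) (mulmxA (selmx i)).
have -> : selmx i *m selmx j = if i == j then selmx i else 0.
  rewrite /selmx mulmx_diag; case: (eqVneq i j) => [<-|ij].
    by congr diag_mx; apply/rowP=> c; rewrite !mxE -natrM mulnb andbb.
  apply/matrixP=> a b; rewrite !mxE -natrM mulnb.
  by case: eqP => [->|_]; rewrite ?(negPf ij) mul0rn.
by case: ifP; rewrite ?mul0mx ?mulmx0.
Qed.

Lemma projmx_sum : \sum_i projmx i = 1%:M.
Proof.
rewrite /projmx -mulmx_suml -mulmx_sumr.
have -> : \sum_i selmx i = 1%:M.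
  apply/matrixP=> a b; rewrite summxE !mxE (bigD1 (tag (idx a))) //= big1 ?addr0.
    by rewrite !mxE eqxx.
  by move=> i ia; rewrite !mxE eq_sym (negPf ia) mul0rn.
by rewrite mulmx1 mulmxV ?formmx_unit.
Qed.

Lemma mul_projmx i (v : 'rV[F]_n) c :
  (v *m projmx i *m formmx) 0 c = (v *m formmx) 0 c * (tag (idx c) == i)%:R.
Proof.
rewrite /projmx !mulmxA (mulmxKV formmx_unit) /selmx.
by rewrite mul_mx_diag !mxE.
Qed.

Lemma lmap_proj i v : lmap i (v *m projmx i) = lmap i v.
Proof. by apply: eq_bigr => j _; rewrite mul_projmx posK eqxx mulr1. Qed.

(** The power basis has unique digits, so the value of [lmap i] determines the coordinates of the
    [i]-th group; [projmx i] kills the rest. *)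
Lemma lmap_inj i (u v : 'rV[F]_n) : u *m projmx i = u -> v *m projmx i = v ->
  lmap i u = lmap i v -> u = v.
Proof.
move=> uQ vQ uv.
pose dig (x : 'rV[F]_n) : {ffun 'I_(ns i) -> 'I_p} := [ffun j =>
  Ordinal (ltn_Fp pr_p ((x *m formmx) 0 (pos (Tagged (fun i => 'I_(ns i)) j))))].
have digE x : lmap i x = \sum_(j < ns i) ((dig x j : nat)%:R : K i) * w i ^+ j.
  by apply: eq_bigr => j _; rewrite ffunE.
have [c [_ cu]] := basis_w (lmap i u).
have euv : dig u = dig v by rewrite -(cu _ (digE u)) -(cu (dig v)) // uv digE.
apply: (can_inj (mulmxK formmx_unit)); apply/rowP=> a.
rewrite -uQ -vQ !mul_projmx; case: eqP => [|_]; last by rewrite !mulr0.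
rewrite -(idxK a); case: (idx a) => i' j /=; rewrite posK /= => ei; subst i'.
have /ffunP/(_ j) := euv; rewrite !ffunE => /(congr1 val) /= e.
by congr (_ * _); apply: val_inj.
Qed.

Lemma lmap_surj i (y : K i) : exists v : 'rV[F]_n, (v *m projmx i == v) && (lmap i v == y).
Proof.
have [c [cE _]] := basis_w y.
pose T j : index := Tagged (fun i => 'I_(ns i)) j.
pose u : 'rV[F]_n := \row_a \sum_(j < ns i) (idx a == T i j)%:R * (c j : nat)%:R.
have uT j : u 0 (pos (T i j)) = (c j : nat)%:R.
  rewrite mxE (bigD1 j) //= posK eqxx mul1r big1 ?addr0 // => j' j'j.
  by rewrite eq_Tagged eq_sym (negPf j'j) mul0r.
pose v := u *m invmx formmx.
have vu : v *m formmx = u by rewrite mulmxKV ?formmx_unit.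
exists v; apply/andP; split; apply/eqP; last first.
  by rewrite cE; apply: eq_bigr => j _; rewrite vu uT emb_natr.
apply: (can_inj (mulmxK formmx_unit)); apply/rowP=> a; rewrite mul_projmx vu.
case: eqP => [_|ai]; first by rewrite mulr1.
rewrite mulr0 mxE big1 // => j _; case: eqP => [e|]; last by rewrite mul0r.
by case: ai; rewrite e.
Qed.

Definition section i (y : K i) : 'rV[F]_n := xchoose (lmap_surj y).

Arguments section i y : clear implicits.

Lemma sectionP i y : section i y *m projmx i = section i y /\ lmap i (section i y) = y.
Proof. by have /andP[/eqP ? /eqP ?] := xchooseP (lmap_surj y). Qed.

Lemma section_lmap i v : section i (lmap i v) = v *m projmx i.
Proof.
apply: (@lmap_inj i); rewrite ?(sectionP _).1 ?(sectionP _).2 //.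
  by rewrite -mulmxA projmx_idem eqxx.
by rewrite lmap_proj.
Qed.

Lemma section_add i : {morph section i : x y / x + y}.
Proof.
move=> x y; apply: (@lmap_inj i); rewrite ?mulmxDl ?(sectionP _).1 //.
by rewrite lmap_add !(sectionP _).2.
Qed.

End Coordinates.

(** * The energy bound *)

Section Box.
Variables (p : nat) (pr_p : prime p) (n : nat) (N : 'I_n -> int) (Hs : 'I_n -> nat).
Local Notation offset := {ffun 'I_n -> 'I_(boxB Hs)}.

Definition boxv (x : offset) : 'rV['F_p]_n := \row_k (pt N x k)%:~R.

Lemma boxv_sub (x y : offset) k :
  (boxv x - boxv y) 0 k = ((x k : nat)%:Z - (y k : nat)%:Z)%:~R.
Proof. by rewrite !mxE -rmorphB /= /pt opprD addrACA subrr add0r. Qed.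

Lemma inbox_dist (x y : offset) k : inbox x -> inbox y ->
  (`|((x k : nat)%:Z - (y k : nat)%:Z)%R| < Hs k)%N.
Proof.
clear pr_p.
move=> /forallP/(_ k) + /forallP/(_ k); move: (nat_of_ord (x k)) (nat_of_ord (y k)) (Hs k).
by move=> a b c; lia.
Qed.

Lemma boxv_inj (x y : offset) : (forall k, Hs k <= p)%N -> inbox x -> inbox y ->
  boxv x = boxv y -> x = y.
Proof.
move=> Hp bx bY e; apply/ffunP=> k; apply/val_inj => /=.
have := boxv_sub x y k; rewrite e subrr mxE => /esym/eqP; rewrite intr_Fp_eq0 //.
have := leq_trans (inbox_dist k bx bY) (Hp k).
clear; move: (nat_of_ord (x k)) (nat_of_ord (y k)) => a b lt.
case: (posnP `|(a%:Z - b%:Z)%R|%N) => [|gt0 /dvdn_leq -/(_ gt0)]; lia.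
Qed.

Lemma boxv_small (M : nat) (x y : offset) : (forall k, Hs k <= M)%N -> inbox x -> inbox y ->
  smallv M (boxv x - boxv y).
Proof.
move=> HM bx bY; apply/forallP=> k; rewrite boxv_sub; apply: small_intr => //.
exact: leq_trans (inbox_dist k bx bY) (HM k).
Qed.
End Box.

Lemma smallv_row_mx (p n1 n2 M : nat) (a : 'rV['F_p]_n1) (b : 'rV['F_p]_n2) :
  smallv M a -> smallv M b -> smallv M (row_mx a b).
Proof.
move=> /forallP sa /forallP sb; apply/forallP=> j; rewrite mxE.
by case: (split j).
Qed.

Lemma energy_le (n : nat) : (0 < n)%N -> exists C e : nat,
  forall (p s : nat) (ns : 'I_s -> nat), prime p -> (forall i, 0 < ns i)%N ->
    (\sum_(i < s) ns i)%N = n ->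
  forall (F : 'I_s -> finFieldType), (forall i, p \in [pchar (F i)]) ->
    (forall i, #|F i| = p ^ ns i)%N ->
  forall (w : forall i, F i), (forall i, @power_basis p (F i) (ns i) (w i)) ->
  forall (L : forall i : 'I_s, 'I_(ns i) -> 'I_n -> 'F_p), forms_lin_indep L ->
  forall (H : nat) (N : 'I_n -> int) (Hs : 'I_n -> nat),
    (0 < H)%N -> (H * H <= p)%N -> (forall k, H <= Hs k <= 2 * H)%N ->
    (energy w L N Hs <= C * lg p ^ e * H ^ (2 * n))%N.
Proof.
move=> n0; have d0 : (0 < n + n)%N by rewrite addn_gt0 n0.
have [C [e bound]] := moment_bound (n + n) d0.
exists (2 ^ n.+1 * C * 4 ^ (2 * n))%N, e.
move=> p s ns pr_p ns0 sum_ns F chF cF w bw L iL H N Hs H0 Hp HsH.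
(* A power of two between [2 * H], which bounds the sides of the box, and [4 * H], which with
   [H * H <= p] gives the range [16 * p] of the moment bound. *)
pose m := (trunc_log 2 H).+2.
have m1 : (2 * H <= 2 ^ m)%N.
  by rewrite expnS leq_mul2l /=; apply: ltnW; apply: trunc_log_ltn.
have m2 : (2 ^ m <= 4 * H)%N.
  rewrite -[m]add2n expnD leq_mul2l /=; exact: trunc_logP.
have mp : ((2 ^ m) ^ 2 <= 16 * p)%N.
  apply: leq_trans (leq_expn2r 2 m2) _; rewrite expnMn leq_mul2l /=.
  by rewrite -mulnn.
have Hsp k : (Hs k <= p)%N.
  have /andP[_ h2] := HsH k; apply: leq_trans h2 _.
  (* For [H = 1] this is [2 <= p]; for [H >= 2] it is [2 * H <= H * H <= p]. *)
  case: H H0 Hp {HsH m m1 m2 mp} => [|[|h]] // _ Hp; first exact: prime_gt1.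
  by apply: leq_trans Hp; rewrite leq_mul2r.
have Hsm k : (Hs k <= 2 ^ m)%N by have /andP[_ h2] := HsH k; apply: leq_trans h2 m1.
pose B := line_blocks pr_p ns0 sum_ns cF (projmx_idem sum_ns iL) (projmx_sum sum_ns iL)
  (fun i y => (sectionP pr_p sum_ns chF bw iL y).1)
  (fun i y => (sectionP pr_p sum_ns chF bw iL y).2)
  (section_lmap pr_p sum_ns chF bw iL)
  (section_add pr_p sum_ns chF bw iL).
have sn : (s <= n)%N.
  by rewrite -sum_ns -[leqLHS]card_ord -sum1_card; apply: leq_sum => i _.
pose V := boxv p N (Hs := Hs).
pose X : {set 'rV['F_p]_(n + n)} := [set row_mx (V q.1) (V q.2) |
  q in [set q : {ffun 'I_n -> 'I_(boxB Hs)} * {ffun 'I_n -> 'I_(boxB Hs)} |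
          inbox q.1 && inbox q.2]].
have inX x x' : inbox x -> inbox x' -> row_mx (V x) (V x') \in X.
  by move=> bx bx'; apply/imsetP; exists (x, x'); rewrite ?inE ?bx.
have close x y : x \in X -> y \in X -> smallv (2 ^ m) (x - y).
  case/imsetP=> [[a a'] /[!inE] /= /andP[ba ba'] ->].
  case/imsetP=> [[b b'] /[!inE] /= /andP[bb bb'] ->].
  by rewrite opp_row_mx add_row_mx; apply: smallv_row_mx; apply: boxv_small.
have mom t : moment B t (2 ^ m) <= C%:R * (lg p)%:R ^+ e.
  apply: bound => //; apply: leq_trans (max_card _) _; rewrite card_ord.
  by apply: leq_trans sn _; apply: leq_addr.
have := card_aligned close mom; set A := [set xy in _ | _] => cA.
have EA : (energy w L N Hs <= #|A|)%N.
  rewrite /energy; set E := [set t | _].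
  pose f (t : {ffun 'I_n -> 'I_(boxB Hs)} * {ffun 'I_n -> 'I_(boxB Hs)} *
    {ffun 'I_n -> 'I_(boxB Hs)} * {ffun 'I_n -> 'I_(boxB Hs)}) :=
    (row_mx (V t.1.1.1) (V t.1.1.2), row_mx (V t.1.2) (V t.2)).
  rewrite -(card_in_imset (f := f) (D := E)).
    apply/subset_leq_card/subsetP=> _ /imsetP[[[[x x'] y] y'] + ->].
    rewrite inE => /and5P[bx bx' bY bY' /forallP eq].
    rewrite inE in_setX !inX //=.
    apply: lines_aligned => i; rewrite /V /boxv -!lam_lmap; exact/eqP.
  move=> [[[x x'] y] y'] [[[u u'] v] v'].
  rewrite !inE => /and5P[bx bx' bY bY' _] /and5P[bu bu' bv bv' _] eq.
  have [e1 e2] := eq_row_mx (congr1 fst eq); have [e3 e4] := eq_row_mx (congr1 snd eq).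
  rewrite (boxv_inj pr_p Hsp bx bu e1) (boxv_inj pr_p Hsp bx' bu' e2).
  by rewrite (boxv_inj pr_p Hsp bY bv e3) (boxv_inj pr_p Hsp bY' bv' e4).
apply: leq_trans EA _; rewrite -(ler_nat rat).
apply: le_trans cA _.
rewrite -!natrX -natrM -!natrM ler_nat.
have s1 : (2 ^ s.+1 <= 2 ^ n.+1)%N by rewrite leq_exp2l.
have mn : ((2 ^ m) ^ (n + n) <= 4 ^ (2 * n) * H ^ (2 * n))%N.
  by rewrite addnn -mul2n -expnMn leq_expn2r.
apply: leq_trans (leq_mul (leq_mul s1 (leqnn _)) mn) _.
by apply/eq_leq; rewrite !mulnA; rewrite -!mulnA; congr (_ * (_ * _))%N; rewrite mulnCA.
Qed.

(** * Powers of [log p] against powers of [p] *)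

Lemma leq_INR (a b : nat) : (a <= b)%N -> Rle (INR a) (INR b).
Proof. by move=> /ssrnat.leP; apply: le_INR. Qed.

Lemma INR_expn (a b : nat) : INR (a ^ b) = pow (INR a) b.
Proof. by elim: b => // b IH; rewrite expnS mult_INR IH. Qed.

(** The logarithm is absorbed by [1 + t <= exp t] at [t = delta * ln p]. *)
Lemma lg_le_Rpower (delta : R) (p : nat) : Rlt 0 delta -> (0 < p)%N ->
  Rle (INR (lg p)) (Rmult (Rplus (Rinv (Rmult delta (ln 2))) 4) (exp (Rmult delta (ln (INR p))))).
Proof.
move=> d0 p0.
have l2 : Rlt 0 (ln 2) by have := ln_lt_2; Lra.lra.
have p1 : Rle 1 (INR p) by apply: (leq_INR p0).
have lp : Rle 0 (ln (INR p)).
  rewrite -ln_1; case: p1 => [lt|<-]; last exact: Rle_refl.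
  by apply/Rlt_le/ln_increasing => //; exact: Rlt_0_1.
have tl : Rle (Rmult (INR (trunc_log 2 p)) (ln 2)) (ln (INR p)).
  rewrite -ln_pow; last exact: Rlt_0_2.
  have h : Rle (pow 2 (trunc_log 2 p)) (INR p).
    by rewrite -[X in Rle (pow X _) _]/(INR 2) -INR_expn; apply: leq_INR; apply: trunc_logP.
  case: h => [lt|->]; last exact: Rle_refl.
  by apply/Rlt_le/ln_increasing => //; apply: pow_lt; exact: Rlt_0_2.
have ex := exp_ineq1_le (Rmult delta (ln (INR p))).
set E := exp _ in ex *.
have E1 : Rle 1 E by have := Rmult_le_pos _ _ (Rlt_le _ _ d0) lp; Lra.lra.
have dl : Rlt 0 (Rmult delta (ln 2)) by apply: Rmult_lt_0_compat.
have t2 : Rle (INR (trunc_log 2 p)) (Rmult (Rinv (Rmult delta (ln 2))) E).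
  apply: (Rmult_le_reg_l (Rmult delta (ln 2))) => //.
  rewrite -Rmult_assoc Rinv_r; last by Lra.lra.
  have := Rmult_le_compat_l delta _ _ (Rlt_le _ _ d0) tl; Lra.nra.
rewrite /lg !S_INR; Lra.lra.
Qed.

Lemma pow_exp (x : R) (e : nat) : pow (exp x) e = exp (Rmult x (INR e)).
Proof.
elim: e => [|e IH]; first by rewrite Rmult_0_r exp_0.
by rewrite S_INR Rmult_plus_distr_l Rmult_1_r exp_plus -IH /= Rmult_comm.
Qed.

Lemma lg_pow_le_Rpower (e : nat) (eps : R) : Rlt 0 eps -> exists2 C : R, Rle 0 C &
  forall p : nat, (0 < p)%N -> Rle (pow (INR (lg p)) e) (Rmult C (Rpower (INR p) eps)).
Proof.
(* Dividing by [e + 1] instead of [e] keeps the case [e = 0] valid; the [e]-th power then costs at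
   most [p ^ eps]. *)
move=> eps0; pose delta := Rdiv eps (INR e.+1).
have e1 : Rlt 0 (INR e.+1) by apply: lt_0_INR; apply/ssrnat.ltP.
have d0 : Rlt 0 delta by apply: Rdiv_lt_0_compat.
have l2 : Rlt 0 (ln 2) by have := ln_lt_2; Lra.lra.
pose A := Rplus (Rinv (Rmult delta (ln 2))) 4.
have A0 : Rle 0 A.
  have : Rlt 0 (Rinv (Rmult delta (ln 2))) by apply/Rinv_0_lt_compat/Rmult_lt_0_compat.
  by rewrite /A; Lra.lra.
exists (pow A e); first exact: pow_le.
move=> p p0; have := lg_le_Rpower d0 p0; rewrite -/A => le.
apply: Rle_trans (pow_incr _ _ e (conj (pos_INR _) le)) _.
rewrite Rpow_mult_distr; apply: Rmult_le_compat_l; first exact: pow_le.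
rewrite pow_exp /Rpower.
have p1 : Rle 1 (INR p) by apply: (leq_INR p0).
have lp : Rle 0 (ln (INR p)).
  rewrite -ln_1; case: p1 => [lt|<-]; last exact: Rle_refl.
  by apply/Rlt_le/ln_increasing => //; exact: Rlt_0_1.
have le2 : Rle (Rmult (Rmult delta (ln (INR p))) (INR e)) (Rmult eps (ln (INR p))).
  have -> : eps = Rmult delta (INR e.+1) by rewrite /delta /Rdiv Rmult_assoc Rinv_l ?Rmult_1_r //; Lra.lra.
  rewrite S_INR; have := Rmult_le_pos _ _ (Rlt_le _ _ d0) lp; Lra.lra.
by case: le2 => [lt|->]; [apply/Rlt_le/exp_increasing | exact: Rle_refl].
Qed.

Local Close Scope ring_scope.

Theorem theorem1p3 :
  forall (n : nat) (eps : R), (1 <= n)%N -> Rlt 0 eps ->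
  exists C : R,
  forall (p s : nat) (ns : 'I_s -> nat),
    prime p ->
    (forall i, 0 < ns i)%N ->
    (\sum_(i < s) ns i)%N = n ->
  forall (F : 'I_s -> finFieldType),
    (forall i, (p \in [pchar (F i)])%R) ->
    (forall i, #|F i| = p ^ ns i)%N ->
  forall (w : forall i, F i),
    (forall i, @power_basis p (F i) (ns i) (w i)) ->
  forall (L : forall i : 'I_s, 'I_(ns i) -> 'I_n -> 'F_p),
    forms_lin_indep L ->
  forall (H : nat) (N : 'I_n -> int) (Hs : 'I_n -> nat),
    (1 <= H)%N -> (H * H <= p)%N ->
    (forall k, H <= Hs k <= 2 * H)%N ->
    Rle (INR (energy w L N Hs))
        (Rmult (Rmult C (pow (INR H) (2 * n))) (Rpower (INR p) eps)).

Proof.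
move=> n eps n0 eps0.
have [C [e bound]] := energy_le n0.
have [D D0 lgD] := lg_pow_le_Rpower e eps0.
exists (Rmult (INR C) D) => p s ns pr_p ns0 sum_ns F chF cF w bw L iL H N Hs H0 Hp HsH.
have le := leq_INR (bound p s ns pr_p ns0 sum_ns F chF cF w bw L iL H N Hs H0 Hp HsH).
apply: Rle_trans le _; rewrite !mult_INR !INR_expn.
have h := lgD p (prime_gt0 pr_p).
have HC : Rle 0 (Rmult (INR C) (pow (INR H) (2 * n))).
  by apply: Rmult_le_pos; [exact: pos_INR | apply/pow_le/pos_INR].
have := Rmult_le_compat_l _ _ _ HC h.
set a := INR C; set b := pow _ e; set c := pow _ _; set q := Rpower _ _.
by move=> h'; Lra.lra.
Qed.
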